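(* Let $\alpha,\beta\in\mathbb{R}\setminus\mathbb{Z}$. Let $Q(x,y)$ be an indefinite binary quadratic form with positive real coefficients and discriminant $1$, and let $0<w'<w$ be the roots of the equation $Q(1,-x)=0$. Let $$Z_Q(s;(\alpha,\beta))=\sum_{p\geq 1,\,q\geq 0}\frac{e^{2\pi i(\alpha p+\beta q)}}{Q(p,q)^s},\qquad \mathrm{Re}(s)>1.$$ Then: (1) $Z_Q(s;(\alpha,\beta))$ is an analytic function in the half-plane $\mathrm{Re}(s)>1/2$; (2) $Z_Q(1;(\alpha,\beta))=\mathscr{F}_2(w';\alpha,\beta)-\mathscr{F}_2(w;\alpha,\beta)$.
   Context: For $\alpha\in\mathbb{R}$, $\beta\in\mathbb{R}\setminus\mathbb{Z}$ and an integer $k\geq1$, the higher Herglotz–Zagier–Novikov function is $$\mathscr{F}_k(x;\alpha,\beta)=\int_0^\infty\frac{\mathrm{Li}_{k-1}(e^{-xt}e^{2\pi i\alpha})}{1-e^{-t}e^{2\pi i\beta}}\,dt,\qquad \mathrm{Re}(x)>0,$$ where $\mathrm{Li}_s(z)=\sum_{n\geq1}z^n/n^s$ is the polylogarithm. For $\mathrm{Re}(x)>0$ one has $\mathscr{F}_k(x;\alpha,\beta)=\sum_{p\geq1,q\geq0}\frac{e^{2\pi i(\alpha p+\beta q)}}{p^{k-1}(px+q)}$. *)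

(* Defs.v *)
From Stdlib Require Import Reals ZArith List.
From Coquelicot Require Import Coquelicot.

Open Scope R_scope.

Definition Cexp (z : C) : C :=
  (exp (Re z) * cos (Im z), exp (Re z) * sin (Im z)).

Definition e2pi (r : R) : C := Cexp (2 * PI * r * Ci)%C.

(* [r^s] for real [r > 0], with the real logarithm; [ln] is a junk value
   for [r <= 0]. *)
Definition Rcpow (r : R) (s : C) : C := Cexp (s * ln r)%C.

(* Sum of a complex series; meaningful only when the series converges
   (Coquelicot's [Series] is restricted to real terms). *)
Definition CSeries (u : nat -> C) : C :=
  iota (fun l : C_CompleteNormedModule =>
          is_series (K := C_AbsRing) (V := C_NormedModule) u l).

(* The index [n] is shifted so that the sum starts at [n = 1]. *)
Definition polylog (s z : C) : C :=
  CSeries (fun n : nat => (Cpow z (S n) / Rcpow (INR (S n)) s)%C).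

(* The integral is improper at both ends: for [k = 1] the integrand may be
   singular at [0]. *)
Definition HZN (k : nat) (x : C) (alpha beta : R) : C :=
  RInt_gen (V := C_R_CompleteNormedModule)
    (fun t : R =>
       (polylog (INR k - 1)%R (Cexp (- (x * t)) * e2pi alpha)
          / (1 - Cexp (- t)%R * e2pi beta))%C)
    (at_right 0) (Rbar_locally p_infty).

Record bqf := Bqf { qa : R; qb : R; qc : R }.

Definition bqf_eval (Q : bqf) (x y : R) : R :=
  qa Q * x ^ 2 + qb Q * x * y + qc Q * y ^ 2.

Definition discriminant (Q : bqf) : R := qb Q ^ 2 - 4 * qa Q * qc Q.

Definition indefinite (Q : bqf) : Prop :=
  (exists x y, 0 < bqf_eval Q x y) /\ (exists x y, bqf_eval Q x y < 0).

Definition non_integer (r : R) : Prop := forall n : Z, r <> IZR n.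

Definition list_sum {T : Type} (f : T -> C) (L : list T) : C :=
  fold_right (fun i acc => f i + acc)%C 0%C L.

(* Unordered summation: the net of finite partial sums, indexed by finite
   subsets of [T] (duplicate-free lists), converges to [l].  For complex
   terms this is absolute convergence with sum [l]. *)
Definition is_unordered_sum {T : Type} (f : T -> C) (l : C) : Prop :=
  forall eps : posreal, exists L0 : list T,
    forall L : list T, NoDup L -> incl L0 L ->
      Cmod (list_sum f L - l)%C < eps.

(* [l] is the value at [s] of the Dirichlet series
   [sum_(p >= 1, q >= 0) e^(2 pi i (alpha p + beta q)) / Q(p,q)^s];
   the index [(m, q)] stands for [p = m + 1]. *)
Definition is_ZQ (Q : bqf) (alpha beta : R) (s l : C) : Prop :=
  is_unordered_sum
    (fun i : nat * nat =>
       let p := INR (S (fst i)) in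
       let q := INR (snd i) in
       (e2pi (alpha * p + beta * q)%R / Rcpow (bqf_eval Q p q) s)%C)
    l.

Definition analytic_at (f : C -> C) (z0 : C) : Prop :=
  exists (a : nat -> C) (r : posreal),
    forall z : C, Cmod (z - z0)%C < r ->
      is_pseries (K := C_AbsRing) (V := C_NormedModule) a (z - z0)%C (f z).

Definition analytic_on (D : C -> Prop) (f : C -> C) : Prop :=
  forall z : C, D z -> analytic_at f z.

(* Main.v *)
(** Write [A = e(alpha)], [B = e(beta)] and [f_s(p,q) = Q(p,q)^(-s)].  One
    summation by parts in [q] replaces [Q^(-s)] by
    [f_s(p,q) - f_s(p,q-1)] (with [f_s(p,-1) = 0]):
    [(1 - B) Z(s) = sum A^p B^q (f_s(p,q) - f_s(p,q-1))].
    The difference is [O((p+q)^(-2 Re s - 1))], so the new double series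
    converges absolutely for [Re s > 1/2]; expanding each term in powers of
    [s - z0] keeps absolute convergence, which gives analyticity.

    At [s = 1], partial fractions give
    [1/Q(p,q) = (1/p) (1/(p w' + q) - 1/(p w + q))], so it remains to see that
    the transformed series with [f(p,q) = 1/(p (p x + q))] has sum
    [(1 - B) F_2(x)].  The integrand of [F_2] differs from a finite sum of
    exponentials over a box of indices by an error whose integral tends to
    [0]: since [A <> 1] and [B <> 1], the denominators [1 - A e^(-xt)] and
    [1 - B e^(-t)] stay away from [0], and Abel summation bounds the tail of
    the logarithm series uniformly up to [t = 0]. *)

From Stdlib Require Import Reals Factorial Lra Lia List Classical IndefiniteDescription.
Require Import Defs.
From Coquelicot Require Import Coquelicot.

(** * Unordered sums *)

(** Neither the series of [1/Q(p,q)] nor that of [1/(p (p x + q))] converges absolutely. At [s = 1]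
    only the transformed sums exist as unordered sums, so the comparison takes place there: partial
    fractions match them term by term and uniqueness of unordered sums does the rest. On the
    integral side the transformed sum is reached from untransformed finite sums over boxes, at the
    price of a boundary term of size [P/(x + N)]; hence the bound [P] on the first index is fixed
    before the bound [N] on the second.

    All absolute convergence of double series comes from one majorant, [(p (q+1))^(-1-eps)], whose
    sum is a product of two zeta sums. A term of order [(p+q)^(-2 sigma - 1)] lies below it with
    [eps = sigma - 1/2], because [(p+q)^2 >= p (q+1)]. The column [q = 0], where no difference is
    taken, only has order [p^(-2 sigma)], but it is one-dimensional.

    For analyticity the moduli of the Taylor coefficients of each term, weighted by [r^n], are
    summed against the same majorant, and a Fubini theorem exchanges the sum over the lattice with
    the sum over [n]. *)

Definition rsum {T : Type} (f : T -> R) (L : list T) : R :=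
  fold_right (fun i acc => f i + acc) 0 L.

Lemma rsum_nonneg {T} (f : T -> R) L : (forall i, 0 <= f i) -> 0 <= rsum f L.
Proof.
  intros Hf; induction L as [|i L IH]; simpl; [lra|].
  specialize (Hf i); lra.
Qed.

Lemma rsum_le {T} (f g : T -> R) L :
  (forall i, f i <= g i) -> rsum f L <= rsum g L.
Proof.
  intros Hf; induction L as [|i L IH]; simpl; [lra|].
  specialize (Hf i); lra.
Qed.

Lemma rsum_scal {T} (f : T -> R) c L :
  rsum (fun i => c * f i) L = c * rsum f L.
Proof. induction L as [|i L IH]; simpl; [ring|rewrite IH; ring]. Qed.

Lemma rsum_app {T} (f : T -> R) L L' : rsum f (L ++ L') = rsum f L + rsum f L'.
Proof. induction L as [|i L IH]; simpl; [ring|rewrite IH; ring]. Qed.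

Lemma rsum_map {T U} (f : U -> R) (g : T -> U) L :
  rsum f (map g L) = rsum (fun i => f (g i)) L.
Proof. induction L as [|i L IH]; simpl; congruence. Qed.

Lemma rsum_ext {T} (f g : T -> R) L : (forall i, f i = g i) -> rsum f L = rsum g L.
Proof. intros H; induction L; simpl; rewrite ?H; congruence. Qed.

Lemma rsum_incl {T} (f : T -> R) L L' :
  (forall i, 0 <= f i) -> NoDup L -> incl L L' -> rsum f L <= rsum f L'.
Proof.
  intros Hf HL; revert L'; induction HL as [|i L Hi HL IH]; intros L' HI; simpl.
  - now apply rsum_nonneg.
  - destruct (in_split i L') as (l1 & l2 & ->); [apply HI; now left|].
    assert (incl L (l1 ++ l2)).
    { intros j Hj; assert (Hj' := HI j (or_intror Hj)).
      apply in_app_or in Hj'; apply in_or_app; destruct Hj' as [|[|]]; auto.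
      subst; contradiction. }
    specialize (IH _ H); rewrite !rsum_app in *; simpl; lra.
Qed.

Lemma rsum_list_prod {T U} (F : T * U -> R) L K :
  rsum F (list_prod L K) = rsum (fun i => rsum (fun j => F (i, j)) K) L.
Proof.
  induction L as [|i L IH]; simpl; [reflexivity|].
  now rewrite rsum_app, rsum_map, IH.
Qed.

Lemma list_sum_app {T} (f : T -> C) L L' :
  list_sum f (L ++ L') = (list_sum f L + list_sum f L')%C.
Proof. induction L as [|i L IH]; simpl; [ring|rewrite IH; ring]. Qed.

Lemma list_sum_map {T U} (f : U -> C) (g : T -> U) L :
  list_sum f (map g L) = list_sum (fun i => f (g i)) L.
Proof. induction L as [|i L IH]; simpl; congruence. Qed.

Lemma list_sum_ext {T} (f g : T -> C) L :
  (forall i, f i = g i) -> list_sum f L = list_sum g L.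
Proof. intros H; induction L; simpl; rewrite ?H; congruence. Qed.

Lemma list_sum_plus {T} (f g : T -> C) L :
  list_sum (fun i => (f i + g i)%C) L = (list_sum f L + list_sum g L)%C.
Proof. induction L as [|i L IH]; simpl; [ring|rewrite IH; ring]. Qed.

Lemma list_sum_scal {T} (f : T -> C) c L :
  list_sum (fun i => (c * f i)%C) L = (c * list_sum f L)%C.
Proof. induction L as [|i L IH]; simpl; [ring|rewrite IH; ring]. Qed.

Lemma list_sum_RtoC {T} (f : T -> R) L :
  list_sum (fun i => RtoC (f i)) L = RtoC (rsum f L).
Proof.
  induction L as [|i L IH]; simpl; [reflexivity|]. now rewrite IH, RtoC_plus.
Qed.

Lemma list_sum_list_prod {T U} (F : T * U -> C) L K :
  list_sum F (list_prod L K) =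
  list_sum (fun i => list_sum (fun j => F (i, j)) K) L.
Proof.
  induction L as [|i L IH]; simpl; [reflexivity|].
  now rewrite list_sum_app, list_sum_map, IH.
Qed.

Lemma list_sum_exchange {T U} (F : T -> U -> C) L K :
  list_sum (fun i => list_sum (F i) K) L =
  list_sum (fun j => list_sum (fun i => F i j) L) K.
Proof.
  induction L as [|i L IH]; simpl.
  - induction K; simpl; [reflexivity|]. rewrite <- IHK; ring.
  - now rewrite IH, list_sum_plus.
Qed.

Lemma Cmod_list_sum {T} (f : T -> C) L :
  Cmod (list_sum f L) <= rsum (fun i => Cmod (f i)) L.
Proof.
  induction L as [|i L IH]; simpl; [rewrite Cmod_0; lra|].
  eapply Rle_trans; [apply Cmod_triangle|lra].
Qed.

(** The index type has no decidable equality, so duplicates are removed by excluded middle on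
    membership. *)
Lemma ex_nodup_equiv {T} (L : list T) :
  exists K, NoDup K /\ incl L K /\ incl K L.
Proof.
  induction L as [|i L (K & HK & H1 & H2)].
  - exists nil; repeat split; [constructor| |]; easy.
  - destruct (classic (In i K)) as [Hi|Hi].
    + exists K; repeat split; auto.
      * intros j [<-|Hj]; auto.
      * intros j Hj; right; auto.
    + exists (i :: K); repeat split.
      * now constructor.
      * intros j [<-|Hj]; [left|right]; auto.
      * intros j [<-|Hj]; [left|right]; auto.
Qed.

Lemma is_unordered_sum_ext {T} (f g : T -> C) l :
  (forall i, f i = g i) -> is_unordered_sum f l -> is_unordered_sum g l.
Proof.
  intros H Hf eps; destruct (Hf eps) as [L0 H0]; exists L0; intros L HL HI.
  rewrite <- (list_sum_ext f g L H); auto.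
Qed.

Lemma is_unordered_sum_plus {T} (f g : T -> C) l m :
  is_unordered_sum f l -> is_unordered_sum g m ->
  is_unordered_sum (fun i => (f i + g i)%C) (l + m)%C.
Proof.
  intros Hf Hg eps.
  destruct (Hf (pos_div_2 eps)) as [L1 H1], (Hg (pos_div_2 eps)) as [L2 H2].
  exists (L1 ++ L2); intros L HL HI.
  rewrite list_sum_plus.
  replace (list_sum f L + list_sum g L - (l + m))%C
    with ((list_sum f L - l) + (list_sum g L - m))%C by ring.
  eapply Rle_lt_trans; [apply Cmod_triangle|].
  assert (A := H1 L HL (fun j Hj => HI j (in_or_app _ _ _ (or_introl Hj)))).
  assert (B := H2 L HL (fun j Hj => HI j (in_or_app _ _ _ (or_intror Hj)))).
  simpl in A, B; lra.
Qed.

Lemma is_unordered_sum_scal {T} (f : T -> C) l c :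
  is_unordered_sum f l -> is_unordered_sum (fun i => (c * f i)%C) (c * l)%C.
Proof.
  intros Hf eps.
  assert (Hc := Cmod_ge_0 c).
  assert (Hd : 0 < eps / (Cmod c + 1)).
  { apply Rdiv_lt_0_compat; [apply cond_pos|lra]. }
  destruct (Hf (mkposreal _ Hd)) as [L0 H0].
  exists L0; intros L HL HI; specialize (H0 L HL HI); simpl in H0.
  rewrite list_sum_scal.
  replace (c * list_sum f L - c * l)%C with (c * (list_sum f L - l))%C by ring.
  rewrite Cmod_mult.
  apply Rle_lt_trans with ((Cmod c) * (eps / (Cmod c + 1))).
  - apply Rmult_le_compat_l; lra.
  - apply Rlt_le_trans with ((Cmod c + 1) * (eps / (Cmod c + 1))).
    + apply Rmult_lt_compat_r; lra.
    + right; field; lra.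
Qed.

Lemma is_unordered_sum_minus {T} (f g : T -> C) l m :
  is_unordered_sum f l -> is_unordered_sum g m ->
  is_unordered_sum (fun i => (f i - g i)%C) (l - m)%C.
Proof.
  intros Hf Hg.
  apply is_unordered_sum_ext with (fun i => (f i + (-1) * g i)%C).
  { intros i; ring. }
  replace (l - m)%C with (l + (-1) * m)%C by ring.
  apply is_unordered_sum_plus; [assumption|].
  now apply is_unordered_sum_scal.
Qed.

(** Lets a single list of columns approximate finitely many row sums at once, as the Fubini theorem
    below requires. *)
Lemma is_unordered_sum_list_sum {T U} (F : T -> U -> C) (g : T -> C) L :
  (forall i, is_unordered_sum (F i) (g i)) ->
  is_unordered_sum (fun j => list_sum (fun i => F i j) L) (list_sum g L).
Proof.
  intros HF; induction L as [|i L IH]; simpl.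
  - intros eps; exists nil; intros K _ _.
    replace (list_sum _ K - 0)%C with (RtoC 0).
    + rewrite Cmod_0; apply cond_pos.
    + induction K as [|k K IHK]; simpl; [ring|].
      transitivity (0 + (list_sum (fun _ => RtoC 0) K - 0))%C; [|ring].
      rewrite <- IHK; ring.
  - now apply is_unordered_sum_plus.
Qed.

Lemma ex_list_sum_close {T} (f : T -> C) l (L1 : list T) (eps : posreal) :
  is_unordered_sum f l ->
  exists L, NoDup L /\ incl L1 L /\ Cmod (list_sum f L - l) < eps.
Proof.
  intros Hf; destruct (Hf eps) as [L0 H0].
  destruct (ex_nodup_equiv (L0 ++ L1)) as (K & HK & H1 & _).
  exists K; repeat split; auto.
  - intros j Hj; apply H1, in_or_app; auto.
  - apply H0; auto; intros j Hj; apply H1, in_or_app; auto.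
Qed.

Lemma NoDup_map_inj {T U} (f : T -> U) L :
  (forall x y, f x = f y -> x = y) -> NoDup L -> NoDup (map f L).
Proof.
  intros Hf HL; induction HL as [|i L Hi HL IH]; simpl; constructor; auto.
  intros Hin; apply in_map_iff in Hin; destruct Hin as (j & E & Hj).
  apply Hf in E; now subst.
Qed.

Lemma NoDup_list_prod {T U} (L : list T) (K : list U) :
  NoDup L -> NoDup K -> NoDup (list_prod L K).
Proof.
  intros HL HK; induction HL as [|i L Hi HL IH]; simpl; [constructor|].
  apply NoDup_app; auto.
  - apply NoDup_map_inj; auto. intros x y; congruence.
  - intros [a b] Ha Hb; apply in_map_iff in Ha; destruct Ha as (? & [= <- <-] & _).
    apply in_prod_iff in Hb; tauto.
Qed.

Lemma incl_list_prod {T U} (L0 : list (T * U)) L K :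
  incl (map fst L0) L -> incl (map snd L0) K -> incl L0 (list_prod L K).
Proof.
  intros H1 H2 [a b] Hab; apply in_prod.
  - apply H1; change a with (fst (a, b)); now apply in_map.
  - apply H2; change b with (snd (a, b)); now apply in_map.
Qed.

(** Once a finite set [L] of rows contains the rows of [L0], one list [K] of columns can be chosen
    that both contains the columns of [L0] and makes the finite row sums over [L] add up to nearly
    [list_sum g L]. The rectangle [L x K] contains [L0], so its sum is also close to [l]. *)
Lemma is_unordered_sum_fubini {T U} (F : T * U -> C) (g : T -> C) l :
  is_unordered_sum F l ->
  (forall i, is_unordered_sum (fun j => F (i, j)) (g i)) ->
  is_unordered_sum g l.
Proof.
  intros HF Hg eps.
  destruct (HF (pos_div_2 eps)) as [L0 H0].
  exists (map fst L0); intros L HL HI.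
  destruct (ex_list_sum_close _ _ (map snd L0) (pos_div_2 eps)
    (is_unordered_sum_list_sum (fun i j => F (i, j)) g L Hg))
    as (K & HK & HIK & H1).
  specialize (H0 (list_prod L K) (NoDup_list_prod _ _ HL HK)
    (incl_list_prod _ _ _ HI HIK)).
  rewrite list_sum_list_prod, list_sum_exchange in H0.
  set (S := list_sum _ K) in *.
  replace (list_sum g L - l)%C with ((S - l) + - (S - list_sum g L))%C by ring.
  eapply Rle_lt_trans; [apply Cmod_triangle|].
  rewrite Cmod_opp; simpl in H0, H1; lra.
Qed.

Lemma is_unordered_sum_bij {T U} (f : U -> C) l (phi : T -> U) (psi : U -> T) :
  (forall i, psi (phi i) = i) -> (forall j, phi (psi j) = j) ->
  is_unordered_sum f l -> is_unordered_sum (fun i => f (phi i)) l.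
Proof.
  intros H1 H2 Hf eps; destruct (Hf eps) as [L0 H0].
  exists (map psi L0); intros L HL HI.
  rewrite <- list_sum_map; apply H0.
  - apply NoDup_map_inj; auto.
    intros x y E; rewrite <- (H1 x), <- (H1 y); congruence.
  - intros j Hj; rewrite <- (H2 j); apply in_map, HI, in_map, Hj.
Qed.

(** * Absolute summability, expressed by a uniform bound on finite sums *)

Definition sums_bounded {T : Type} (f : T -> R) (M : R) : Prop :=
  forall L : list T, NoDup L -> rsum f L <= M.

(** The sum is the supremum of the finite sums; by monotonicity, every list containing a
    near-optimal one is near-optimal. *)
Lemma sums_bounded_nonneg_sum {T} (f : T -> R) M :
  (forall i, 0 <= f i) -> sums_bounded f M ->
  exists l, is_unordered_sum (fun i => RtoC (f i)) l.
Proof.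
  intros Hf HM.
  destruct (completeness (fun x => exists L, NoDup L /\ x = rsum f L)) as [S [HS1 HS2]].
  - exists M; intros x (L & HL & ->); auto.
  - exists 0, nil; split; [constructor|reflexivity].
  - exists (RtoC S); intros eps.
    assert (exists L0, NoDup L0 /\ S - eps < rsum f L0) as (L0 & HL0 & H0).
    { apply NNPP; intros HN.
      assert (S <= S - eps); [|generalize (cond_pos eps); lra].
      apply HS2; intros x (L & HL & ->).
      apply Rnot_lt_le; intros Hlt; apply HN; eauto. }
    exists L0; intros L HL HI.
    rewrite list_sum_RtoC, <- RtoC_minus, Cmod_R.
    assert (rsum f L <= S) by (apply HS1; eauto).
    assert (rsum f L0 <= rsum f L) by now apply rsum_incl.
    apply Rabs_def1; lra.
Qed.

Lemma sums_bounded_le {T} (f g : T -> R) M :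
  (forall i, f i <= g i) -> sums_bounded g M -> sums_bounded f M.
Proof.
  intros H HM L HL; eapply Rle_trans; [now apply rsum_le|auto].
Qed.

Lemma sums_bounded_scal {T} (f : T -> R) c M :
  0 <= c -> sums_bounded f M -> sums_bounded (fun i => c * f i) (c * M).
Proof.
  intros Hc HM L HL; rewrite rsum_scal; apply Rmult_le_compat_l; auto.
Qed.

Lemma im_le_Cmod (z : C) : Rabs (Im z) <= Cmod z.
Proof. eapply Rle_trans; [apply Rmax_r|apply Rmax_Cmod]. Qed.

(** Reduction to nonnegative families: [Re f + |f|], [Im f + |f|] and [|f|] are nonnegative with
    bounded finite sums, and [f = (Re f + |f|) + i (Im f + |f|) - (1 + i) |f|]. *)
Lemma sums_bounded_ex_sum {T} (f : T -> C) M :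
  sums_bounded (fun i => Cmod (f i)) M -> exists l, is_unordered_sum f l.
Proof.
  intros HM.
  assert (H2 : forall g : T -> R, (forall i, Rabs (g i) <= Cmod (f i)) ->
    exists l, is_unordered_sum (fun i => RtoC (g i + Cmod (f i))) l).
  { intros g Hg; apply sums_bounded_nonneg_sum with (2 * M).
    - intros i; specialize (Hg i); apply Rabs_le_between in Hg; lra.
    - apply sums_bounded_le with (fun i => 2 * Cmod (f i)).
      + intros i; specialize (Hg i); apply Rabs_le_between in Hg; lra.
      + apply sums_bounded_scal; [lra|assumption]. }
  destruct (H2 (fun i => Re (f i)) (fun i => re_le_Cmod _)) as [l1 H3].
  destruct (H2 (fun i => Im (f i)) (fun i => im_le_Cmod _)) as [l2 H4].
  destruct (sums_bounded_nonneg_sum _ M (fun i => Cmod_ge_0 (f i)) HM) as [l0 H5].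
  exists (l1 + Ci * l2 - (1 + Ci) * l0)%C.
  eapply is_unordered_sum_ext;
    [|apply is_unordered_sum_minus;
      [apply is_unordered_sum_plus; [exact H3|apply is_unordered_sum_scal, H4]
      |apply is_unordered_sum_scal, H5]].
  intros i; cbv beta; generalize (Cmod (f i)); intros c.
  destruct (f i) as [x y]; apply injective_projections; simpl; ring.
Qed.

(** Every finite set of pairs lies in the rectangle spanned by its two projections, and a rectangle
    can be summed row by row. *)
Lemma sums_bounded_prod {T U} (F : T * U -> R) (b : T -> R) M :
  (forall x, 0 <= F x) ->
  (forall i, sums_bounded (fun j => F (i, j)) (b i)) -> sums_bounded b M ->
  sums_bounded F M.
Proof.
  intros HF Hb HM L HL.
  destruct (ex_nodup_equiv (map fst L)) as (L1 & HL1 & HI1 & _).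
  destruct (ex_nodup_equiv (map snd L)) as (L2 & HL2 & HI2 & _).
  apply Rle_trans with (rsum F (list_prod L1 L2)).
  - apply rsum_incl; auto; now apply incl_list_prod.
  - rewrite rsum_list_prod; eapply Rle_trans; [|exact (HM L1 HL1)].
    apply rsum_le; intros i; now apply Hb.
Qed.

(** * Unordered sums over the natural numbers and ordinary series *)

Lemma incl_seq_max (L : list nat) : exists N, forall n, (N <= n)%nat -> incl L (seq 0 n).
Proof.
  induction L as [|i L [N HN]].
  - exists 0%nat; intros n _ j [].
  - exists (max N (S i)); intros n Hn j [<-|Hj].
    + apply in_seq; lia.
    + apply (HN n); [lia|exact Hj].
Qed.

Lemma sums_bounded_nat (f : nat -> R) M :
  (forall i, 0 <= f i) -> (forall N, rsum f (seq 0 N) <= M) -> sums_bounded f M.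
Proof.
  intros Hf HM L HL; destruct (incl_seq_max L) as [N HN].
  eapply Rle_trans; [|apply (HM N)].
  apply rsum_incl; auto.
Qed.

Lemma list_sum_seq_S (f : nat -> C) N :
  list_sum f (seq 0 (S N)) = (list_sum f (seq 0 N) + f N)%C.
Proof. rewrite seq_S, list_sum_app; simpl; ring. Qed.

Lemma rsum_seq_S (f : nat -> R) N :
  rsum f (seq 0 (S N)) = rsum f (seq 0 N) + f N.
Proof. rewrite seq_S, rsum_app; simpl; ring. Qed.

Lemma list_sum_seq (f : nat -> C) N :
  list_sum f (seq 0 (S N)) = sum_n (G := C_AbelianMonoid) f N.
Proof.
  induction N as [|N IH].
  - rewrite sum_O; simpl; ring.
  - now rewrite list_sum_seq_S, IH, sum_Sn.
Qed.

Lemma rsum_seq (f : nat -> R) N : rsum f (seq 0 (S N)) = sum_n f N.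
Proof.
  induction N as [|N IH].
  - rewrite sum_O; simpl; ring.
  - now rewrite rsum_seq_S, IH, sum_Sn.
Qed.

(** Puts series and unordered sums in the same language. The partial sum over [seq 0 N] stops at
    [N - 1], while [sum_n u N] includes the index [N]; this accounts for the shift of [N0]. *)
Lemma is_series_C_iff (u : nat -> C) (l : C) :
  is_series (K := C_AbsRing) (V := C_NormedModule) u l <->
  forall eps : posreal, exists N0, forall N, (N0 <= N)%nat ->
    Cmod (list_sum u (seq 0 N) - l) < eps.
Proof.
  unfold is_series.
  destruct (filterlim_locally_ball_norm (U := C_NormedModule) (F := eventually)
    (sum_n u) l) as [E1 E2].
  split; [intros H eps; destruct (E1 H eps) as [N0 HN]
         |intros H; apply E2; intros eps; destruct (H eps) as [N0 HN]].
  - exists (S N0); intros [|N] Hn; [lia|].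
    rewrite list_sum_seq; apply HN; lia.
  - exists N0; intros N Hn; unfold ball_norm; simpl.
    change (Cmod (sum_n (G := C_AbelianMonoid) u N - l) < eps).
    rewrite <- list_sum_seq; apply HN; lia.
Qed.

Lemma is_unordered_sum_series (u : nat -> C) l :
  is_unordered_sum u l ->
  is_series (K := C_AbsRing) (V := C_NormedModule) u l.
Proof.
  intros Hu; apply is_series_C_iff; intros eps.
  destruct (Hu eps) as [L0 H0]; destruct (incl_seq_max L0) as [N HN].
  exists N; intros n Hn; apply H0; [apply seq_NoDup|auto].
Qed.

Lemma is_series_C_unique (u : nat -> C) (l m : C) :
  is_series (K := C_AbsRing) (V := C_NormedModule) u l ->
  is_series (K := C_AbsRing) (V := C_NormedModule) u m -> l = m.
Proof.
  rewrite !is_series_C_iff; intros Hl Hm.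
  apply NNPP; intros Hne.
  assert (Hd : 0 < Cmod (l - m)).
  { apply Cmod_gt_0; intros E; apply Hne.
    replace l with (l - m + m)%C by ring; rewrite E; ring. }
  destruct (Hl (pos_div_2 (mkposreal _ Hd))) as [N1 H1].
  destruct (Hm (pos_div_2 (mkposreal _ Hd))) as [N2 H2].
  specialize (H1 (max N1 N2) ltac:(lia)); specialize (H2 (max N1 N2) ltac:(lia)).
  simpl in H1, H2; set (S := list_sum u _) in *.
  assert (E : (l - m = - (S - l) + (S - m))%C) by ring.
  assert (Ht := Cmod_triangle (- (S - l)) (S - m)).
  rewrite <- E, Cmod_opp in Ht; lra.
Qed.

Lemma CSeries_unique (u : nat -> C) (l : C) :
  is_series (K := C_AbsRing) (V := C_NormedModule) u l -> CSeries u = l.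
Proof.
  intros H; unfold CSeries.
  apply (iota_unique (V := C_CompleteNormedModule)); [|exact H].
  intros y Hy; exact (is_series_C_unique u y l Hy H).
Qed.

(** * The complex exponential *)

Lemma C_ext (a b : C) : Re a = Re b -> Im a = Im b -> a = b.
Proof. destruct a, b; unfold Re, Im; simpl; congruence. Qed.

Lemma Cexp_plus (a b : C) : Cexp (a + b)%C = (Cexp a * Cexp b)%C.
Proof.
  destruct a as [x y], b as [u v]; unfold Cexp, Cmult, Re, Im; simpl.
  rewrite exp_plus, cos_plus, sin_plus; f_equal; ring.
Qed.

Lemma Cexp_RtoC (r : R) : Cexp r = RtoC (exp r).
Proof.
  unfold Cexp, RtoC, Re, Im; simpl; rewrite cos_0, sin_0; f_equal; ring.
Qed.

Lemma Cexp_0 : Cexp 0 = 1.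
Proof. now rewrite Cexp_RtoC, exp_0. Qed.

Lemma Cmod_Cexp (z : C) : Cmod (Cexp z) = exp (Re z).
Proof.
  unfold Cmod, Cexp; simpl.
  replace (exp (Re z) * cos (Im z) * (exp (Re z) * cos (Im z) * 1)
    + exp (Re z) * sin (Im z) * (exp (Re z) * sin (Im z) * 1))
    with (Rsqr (exp (Re z)) * (Rsqr (sin (Im z)) + Rsqr (cos (Im z))))
    by (unfold Rsqr; ring).
  rewrite sin2_cos2, Rmult_1_r; apply sqrt_Rsqr, Rlt_le, exp_pos.
Qed.

Lemma Cexp_neq_0 (z : C) : Cexp z <> 0.
Proof. apply Cmod_gt_0; rewrite Cmod_Cexp; apply exp_pos. Qed.

Lemma Cexp_opp (z : C) : Cexp (- z)%C = (/ Cexp z)%C.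
Proof.
  assert (H := Cexp_plus z (- z)).
  replace (z + - z)%C with (RtoC 0) in H by ring; rewrite Cexp_0 in H.
  assert (Hz := Cexp_neq_0 z).
  transitivity (/ Cexp z * (Cexp z * Cexp (- z)))%C; [field; auto|].
  rewrite <- H; ring.
Qed.

(** Taylor's formula with Lagrange remainder concerns real functions, so the complex exponential is
    restricted to a ray and projected. The factor [c] selects the projection: [c = 1] gives the real
    part and [c = -i] the imaginary part. *)
Lemma is_derive_Re_Cexp (c w : C) (t : R) :
  is_derive (fun t : R => Re (c * Cexp (t * w))) t (Re (c * w * Cexp (t * w))).
Proof.
  destruct c as [c d], w as [x y].
  apply is_derive_ext with
    (fun t : R => exp (t * x) * (c * cos (t * y) - d * sin (t * y))).
  { intros u; unfold Cexp, Cmult, RtoC, Re, Im; simpl.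
    replace (u * x - 0 * y) with (u * x) by ring.
    replace (u * y + 0 * x) with (u * y) by ring; ring. }
  replace (Re _) with (exp (t * x) *
    ((c * x - d * y) * cos (t * y) - (c * y + d * x) * sin (t * y))).
  2:{ unfold Cexp, Cmult, RtoC, Re, Im; simpl.
    replace (t * x - 0 * y) with (t * x) by ring.
    replace (t * y + 0 * x) with (t * y) by ring; ring. }
  auto_derive; [trivial|ring].
Qed.

Lemma is_derive_n_Re_Cexp (c w : C) (n : nat) (t : R) :
  is_derive_n (fun t : R => Re (c * Cexp (t * w))) n t
    (Re (c * w ^ n * Cexp (t * w))).
Proof.
  revert t; induction n as [|n IH]; intros t.
  - simpl; f_equal; ring.
  - apply is_derive_ext with (fun t : R => Re (c * w ^ n * Cexp (t * w))).
    + intros u; symmetry; now apply is_derive_n_unique.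
    + replace (c * w ^ S n)%C with (c * w ^ n * w)%C by (rewrite Cpow_S; ring).
      apply is_derive_Re_Cexp.
Qed.

Definition exp_coef (n : nat) : R := / INR (fact n).

Lemma exp_coef_pos n : 0 < exp_coef n.
Proof. apply Rinv_0_lt_compat, INR_fact_lt_0. Qed.

Lemma exp_coef_S n : INR (S n) * exp_coef (S n) = exp_coef n.
Proof.
  unfold exp_coef; rewrite fact_simpl, mult_INR; field; split.
  - apply INR_fact_neq_0.
  - apply not_0_INR; lia.
Qed.

Lemma is_series_exp (x : R) : is_series (fun n => x ^ n * exp_coef n) (exp x).
Proof.
  assert (H := is_exp_Reals x); unfold is_pseries in H.
  eapply is_series_ext; [|exact H].
  intros n; simpl; rewrite pow_n_pow; reflexivity.
Qed.

Lemma exp_partial_sum (x : R) N :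
  0 <= x -> rsum (fun n => x ^ n * exp_coef n) (seq 0 N) <= exp x.
Proof.
  intros Hx.
  assert (Hp : forall n, 0 <= x ^ n * exp_coef n).
  { intros n; apply Rmult_le_pos; [now apply pow_le|left; apply exp_coef_pos]. }
  apply Rle_trans with (rsum (fun n => x ^ n * exp_coef n) (seq 0 (S N))).
  { rewrite rsum_seq_S; generalize (Hp N); lra. }
  rewrite rsum_seq.
  apply (is_lim_seq_incr_compare _ _ (is_series_exp x)).
  intros n; rewrite sum_Sn; unfold plus; simpl (AbelianMonoid.sort _);
  generalize (Hp (S n)); simpl; lra.
Qed.

(** Taylor's formula on [[0, 1]] for [t |-> Re (c e^(t w))]. At the intermediate point [z] the
    remainder contains [e^(z Re w)], which is at most [e^|Re w|]. *)
Lemma Cexp_taylor (c w : C) (N : nat) :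
  Rabs (Re (c * Cexp w) -
    Re (c * list_sum (fun n => w ^ n * RtoC (exp_coef n))%C (seq 0 (S N))))
  <= Cmod c * exp (Rabs (Re w)) * (Cmod w ^ S N * exp_coef (S N)).
Proof.
  destruct (Taylor_Lagrange (fun t : R => Re (c * Cexp (t * w))) N 0 1)
    as (z & Hz & E); [lra| |].
  { intros t _ k _; destruct k as [|k]; [exact I|].
    exists (Re (c * w ^ S k * Cexp (t * w))); apply (is_derive_n_Re_Cexp c w (S k)). }
  cbv beta in E; rewrite Cmult_1_l in E.
  assert (Es : forall n, sum_f_R0 (fun m => (1 - 0) ^ m / INR (fact m) *
      Derive_n (fun t : R => Re (c * Cexp (t * w))) m 0) n =
      Re (c * list_sum (fun n => w ^ n * RtoC (exp_coef n))%C (seq 0 (S n)))).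
  { assert (Ht : forall m, (1 - 0) ^ m / INR (fact m) *
      Derive_n (fun t : R => Re (c * Cexp (t * w))) m 0 =
      Re (c * (w ^ m * RtoC (exp_coef m)))).
    { intros m; rewrite (is_derive_n_unique _ _ _ _ (is_derive_n_Re_Cexp c w m 0)).
      rewrite Cmult_0_l, Cexp_0, Rminus_0_r, pow1, Cmult_1_r, Cmult_assoc, re_scal_r.
      unfold exp_coef, Rdiv; ring. }
    induction n as [|n IH].
    - etransitivity; [exact (Ht 0%nat)|]; simpl; f_equal; ring.
    - rewrite list_sum_seq_S, Cmult_plus_distr_l, tech5.
      rewrite re_plus, <- IH, Ht; reflexivity. }
  rewrite Es, (is_derive_n_unique _ _ _ _ (is_derive_n_Re_Cexp c w (S N) z)) in E.
  rewrite E; clear E Es.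
  replace (_ + _ - _) with
    ((1 - 0) ^ S N / INR (fact (S N)) * Re (c * w ^ S N * Cexp (z * w))) by ring.
  rewrite Rminus_0_r, pow1, Rabs_mult; fold (Rdiv 1 (INR (fact (S N)))).
  replace (1 / INR (fact (S N))) with (exp_coef (S N)) by (unfold exp_coef; field; apply INR_fact_neq_0).
  rewrite (Rabs_pos_eq (exp_coef _)) by (left; apply exp_coef_pos).
  assert (H1 := re_le_Cmod (c * w ^ S N * Cexp (z * w))).
  rewrite !Cmod_mult, Cmod_pow, Cmod_Cexp, re_scal_l in H1.
  assert (H2 : exp (z * Re w) <= exp (Rabs (Re w))).
  { assert (z * Re w <= Rabs (Re w)).
    { apply Rle_trans with (Rabs (z * Re w)); [apply Rle_abs|].
      rewrite Rabs_mult, (Rabs_pos_eq z) by lra.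
      generalize (Rabs_pos (Re w)); nra. }
    destruct (Rle_lt_or_eq_dec _ _ H) as [H0|H0]; [|rewrite H0; lra].
    left; now apply exp_increasing. }
  rewrite (Rmult_comm (exp_coef _)).
  apply Rle_trans with (Cmod c * Cmod w ^ S N * exp (Rabs (Re w)) * exp_coef (S N)).
  - apply Rmult_le_compat_r; [left; apply exp_coef_pos|].
    eapply Rle_trans; [exact H1|].
    apply Rmult_le_compat_l; [|exact H2].
    apply Rmult_le_pos; [apply Cmod_ge_0|apply pow_le, Cmod_ge_0].
  - right; ring.
Qed.

Lemma Cmod_le_Re_Im (z : C) : Cmod z <= Rabs (Re z) + Rabs (Im z).
Proof.
  destruct z as [x y].
  replace (x, y) with (RtoC x + Ci * RtoC y)%C
    by (apply C_ext; unfold Re, Im, Ci; simpl; ring).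
  eapply Rle_trans; [apply Cmod_triangle|].
  rewrite Cmod_mult, Cmod_Ci, !Cmod_R; unfold Re, Im, Ci; simpl.
  right; f_equal; [f_equal; ring|rewrite Rmult_1_l; f_equal; ring].
Qed.

Lemma is_series_Cexp (w : C) :
  is_series (K := C_AbsRing) (V := C_NormedModule)
    (fun n => w ^ n * RtoC (exp_coef n))%C (Cexp w).
Proof.
  apply is_series_C_iff; intros eps.
  assert (H0 : is_lim_seq (fun n => Cmod w ^ n * exp_coef n) 0).
  { apply ex_series_lim_0; eexists; apply is_series_exp. }
  (* The factor 2 collects the remainders of the real and of the imaginary part. *)
  set (K := 2 * exp (Rabs (Re w))).
  assert (HK : 0 < K) by (unfold K; generalize (exp_pos (Rabs (Re w))); lra).
  assert (He : 0 < eps / K) by (apply Rdiv_lt_0_compat; [apply cond_pos|auto]).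
  apply is_lim_seq_spec in H0; destruct (H0 (mkposreal _ He)) as [N0 HN].
  exists (S N0); intros [|N] Hn; [lia|].
  set (S1 := list_sum _ (seq 0 (S N))).
  assert (H1 := Cexp_taylor 1 w N); assert (H2 := Cexp_taylor (- Ci) w N).
  fold S1 in H1, H2.
  rewrite Cmod_opp, Cmod_Ci in H2; rewrite Cmod_1 in H1.
  assert (Hb := HN (S N) ltac:(lia)); simpl pos in Hb; rewrite Rminus_0_r in Hb.
  rewrite Rabs_pos_eq in Hb.
  2:{ apply Rmult_le_pos; [apply pow_le, Cmod_ge_0|left; apply exp_coef_pos]. }
  set (T := Cmod w ^ S N * exp_coef (S N)) in *.
  assert (H3 : K * T < eps).
  { apply Rmult_lt_compat_l with (r := K) in Hb; [|assumption].
    replace (K * (eps / K)) with (pos eps) in Hb by (field; lra); exact Hb. }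
  rewrite <- Cmod_opp; replace (- (S1 - Cexp w))%C with (Cexp w - S1)%C by ring.
  eapply Rle_lt_trans; [apply Cmod_le_Re_Im|].
  replace (Re (Cexp w - S1)) with (Re (1 * Cexp w) - Re (1 * S1))
    by (unfold Re; simpl; ring).
  replace (Im (Cexp w - S1)) with (Re (- Ci * Cexp w) - Re (- Ci * S1))
    by (unfold Re, Im; simpl; ring).
  unfold K in H3; lra.
Qed.

(** * Domination by a product of zeta series *)

Lemma exp_le_compat (x y : R) : x <= y -> exp x <= exp y.
Proof.
  intros [H|H]; [left; now apply exp_increasing|rewrite H; lra].
Qed.

Lemma ln_nonneg (x : R) : 1 <= x -> 0 <= ln x.
Proof. intros H; rewrite <- ln_1; apply ln_le; lra. Qed.

Lemma ln_le_sub_1 (x : R) : 0 < x -> ln x <= x - 1.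
Proof.
  intros H; assert (H1 := exp_ineq1_le (ln x)); rewrite exp_ln in H1; lra.
Qed.

(** This is [(k+1)^(-1-eps)], written so that comparing terms becomes a linear inequality between
    logarithms. *)
Definition zeta_term (eps : R) (k : nat) : R := exp (- (1 + eps) * ln (INR (S k))).

Lemma zeta_term_pos eps k : 0 < zeta_term eps k.
Proof. apply exp_pos. Qed.

Lemma INR_S_pos k : 0 < INR (S k).
Proof. apply lt_0_INR; lia. Qed.

(* Integral test in the telescoping form
   [eps (k+1)^(-1-eps) <= k^(-eps) - (k+1)^(-eps)]. *)
Lemma zeta_partial_sum eps N : 0 < eps ->
  rsum (zeta_term eps) (seq 0 (S N)) <=
  1 + / eps * (1 - exp (- eps * ln (INR (S N)))).
Proof.
  intros He; induction N as [|N IH].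
  - unfold zeta_term; simpl; rewrite ln_1, !Rmult_0_r, exp_0; lra.
  - rewrite rsum_seq_S.
    assert (Hk := INR_S_pos N); assert (Hk1 := INR_S_pos (S N)).
    set (y := INR (S N)) in *.
    assert (Ey : INR (S (S N)) = y + 1) by (rewrite S_INR; reflexivity).
    assert (Et : zeta_term eps (S N) = exp (- eps * ln (y + 1)) * / (y + 1)).
    { unfold zeta_term; rewrite Ey.
      replace (- (1 + eps) * ln (y + 1)) with (- eps * ln (y + 1) + - ln (y + 1)) by ring.
      rewrite exp_plus, exp_Ropp, exp_ln by lra; reflexivity. }
    assert (El : / (y + 1) <= ln (y + 1) - ln y).
    { assert (H := ln_le_sub_1 (y / (y + 1)) ltac:(apply Rdiv_lt_0_compat; lra)).
      unfold Rdiv in H; rewrite ln_mult, ln_Rinv in H; try lra;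
        [|apply Rinv_0_lt_compat; lra].
      replace (y * / (y + 1) - 1) with (- / (y + 1)) in H by (field; lra); lra. }
    assert (Hg : exp (- eps * ln y) =
      exp (- eps * ln (y + 1)) * exp (eps * (ln (y + 1) - ln y))).
    { rewrite <- exp_plus; f_equal; ring. }
    assert (H1 := exp_ineq1_le (eps * (ln (y + 1) - ln y))).
    assert (H2 := exp_pos (- eps * ln (y + 1))).
    rewrite Ey in *; set (E := exp (- eps * ln (y + 1))) in *.
    assert (E * (1 + eps * / (y + 1)) <= exp (- eps * ln y)).
    { rewrite Hg; apply Rmult_le_compat_l; [lra|].
      apply Rle_trans with (2 := H1).
      apply Rplus_le_compat_l, Rmult_le_compat_l; lra. }
    rewrite Et.
    assert (E * / (y + 1) <= / eps * (exp (- eps * ln y) - E)).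
    { apply Rmult_le_reg_l with eps; [lra|].
      replace (eps * (/ eps * (exp (- eps * ln y) - E)))
        with (exp (- eps * ln y) - E) by (field; lra); nra. }
    nra.
Qed.

Lemma zeta_sums_bounded eps : 0 < eps -> sums_bounded (zeta_term eps) (1 + / eps).
Proof.
  intros He; apply sums_bounded_nat.
  - intros i; left; apply zeta_term_pos.
  - intros N; apply Rle_trans with (rsum (zeta_term eps) (seq 0 (S N))).
    + rewrite rsum_seq_S; generalize (zeta_term_pos eps N); lra.
    + eapply Rle_trans; [now apply zeta_partial_sum|].
      assert (H := exp_pos (- eps * ln (INR (S N)))).
      assert (0 < / eps) by now apply Rinv_0_lt_compat.
      nra.
Qed.

(** The common majorant of the double series; its product form reduces summability to dimension
    one. *)
Definition zeta2_term (eps : R) (i : nat * nat) : R :=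
  zeta_term eps (fst i) * zeta_term eps (snd i).

Lemma zeta2_sums_bounded eps : 0 < eps ->
  sums_bounded (zeta2_term eps) ((1 + / eps) * (1 + / eps)).
Proof.
  intros He; apply sums_bounded_prod with (fun m => (1 + / eps) * zeta_term eps m).
  - intros i; left; apply Rmult_lt_0_compat; apply zeta_term_pos.
  - intros m; rewrite Rmult_comm.
    apply (sums_bounded_scal (zeta_term eps) (zeta_term eps m)).
    + left; apply zeta_term_pos.
    + now apply zeta_sums_bounded.
  - apply sums_bounded_scal; [|now apply zeta_sums_bounded].
    generalize (Rinv_0_lt_compat _ He); lra.
Qed.

Definition lattice_norm (m q : nat) : R := INR (S m) + INR q.

Lemma lattice_norm_ge m q : INR (S m) <= lattice_norm m q /\ INR (S q) <= lattice_norm m q.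
Proof.
  unfold lattice_norm; rewrite !S_INR.
  generalize (pos_INR m) (pos_INR q); lra.
Qed.

Lemma lattice_norm_ge_1 m q : 1 <= lattice_norm m q.
Proof.
  unfold lattice_norm; rewrite S_INR; generalize (pos_INR m) (pos_INR q); lra.
Qed.

Lemma ln_lattice_norm m q :
  0 <= ln (INR (S m)) <= ln (lattice_norm m q) /\
  0 <= ln (INR (S q)) <= ln (lattice_norm m q).
Proof.
  destruct (lattice_norm_ge m q).
  repeat split; try (apply ln_le; [apply INR_S_pos|assumption]);
  apply ln_nonneg; rewrite S_INR; generalize (pos_INR m) (pos_INR q); lra.
Qed.

(** With [p = m + 1 >= 1], the norm [p + q] is at least [p] and at least [q + 1], so its square
    dominates [p (q+1)]. *)
Lemma lattice_norm_le_zeta2 eps m q : 0 < eps ->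
  exp (- (2 * (1 + eps)) * ln (lattice_norm m q)) <= zeta2_term eps (m, q).
Proof.
  intros He; unfold zeta2_term, zeta_term; simpl fst; simpl snd.
  rewrite <- exp_plus; apply exp_le_compat.
  destruct (ln_lattice_norm m q); nra.
Qed.

(** On the axis the second zeta factor is 1, so any exponent of at least [1 + eps] would do. The
    choice [1 + 2 eps] equals [2 tau] for [eps = tau - 1/2], the value that the off-axis terms call
    for. *)
Lemma axis_le_zeta2 eps m : 0 < eps ->
  exp (- (1 + 2 * eps) * ln (lattice_norm m 0)) <= zeta2_term eps (m, 0%nat).
Proof.
  intros He; unfold zeta2_term, zeta_term; simpl fst; simpl snd.
  replace (INR 1) with 1 by reflexivity.
  rewrite <- exp_plus, ln_1; apply exp_le_compat.
  destruct (ln_lattice_norm m 0); nra.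
Qed.

Lemma zeta2_dominated_sum (f : nat * nat -> C) eps K :
  0 < eps -> 0 <= K -> (forall i, Cmod (f i) <= K * zeta2_term eps i) ->
  exists l, is_unordered_sum f l.
Proof.
  intros He HK Hf.
  apply sums_bounded_ex_sum with (K * ((1 + / eps) * (1 + / eps))).
  apply (sums_bounded_le _ _ _ Hf), sums_bounded_scal; [assumption|].
  now apply zeta2_sums_bounded.
Qed.

Lemma pow_diff_le (x y M : R) (n : nat) :
  Rabs x <= M -> Rabs y <= M ->
  Rabs (x ^ S n - y ^ S n) <= INR (S n) * Rabs (x - y) * M ^ n.
Proof.
  intros Hx Hy; assert (HM := Rle_trans _ _ _ (Rabs_pos x) Hx).
  induction n as [|n IH].
  - simpl; rewrite !Rmult_1_r; lra.
  - replace (x ^ S (S n) - y ^ S (S n))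
      with (x * (x ^ S n - y ^ S n) + (x - y) * y ^ S n) by (simpl; ring).
    eapply Rle_trans; [apply Rabs_triang|]; rewrite !Rabs_mult, <- (RPow_abs y).
    assert (Rabs y ^ S n <= M ^ S n) by (apply pow_incr; split; [apply Rabs_pos|assumption]).
    rewrite (S_INR (S n)).
    apply Rle_trans with
      (M * (INR (S n) * Rabs (x - y) * M ^ n) + Rabs (x - y) * M ^ S n).
    + apply Rplus_le_compat.
      * apply Rmult_le_compat; auto using Rabs_pos.
      * apply Rmult_le_compat_l; auto using Rabs_pos.
    + right; simpl; ring.
Qed.

(** The summands are the moduli of the Taylor coefficients in [h] of [e1 e^(x1 h) - e2 e^(x2 h)],
    weighted by [r^n]. Splitting [x1^n e1 - x2^n e2 = e1 (x1^n - x2^n) + (e1 - e2) x2^n] makes each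
    part carry a difference, so the smallness of the difference survives the expansion. *)
Lemma coef_diff_le (x1 x2 M r : R) (e1 e2 : C) (N : nat) :
  Rabs x1 <= M -> Rabs x2 <= M -> 0 <= r ->
  rsum (fun n => Cmod ((RtoC x1 ^ n * e1 - RtoC x2 ^ n * e2) * RtoC (exp_coef n)) * r ^ n)
    (seq 0 N) <=
  Cmod e1 * (r * Rabs (x1 - x2) * exp (r * M)) + Cmod (e1 - e2) * exp (r * Rabs x2).
Proof.
  intros H1 H2 Hr.
  assert (HM := Rle_trans _ _ _ (Rabs_pos _) H1).
  assert (Hx2 := Rabs_pos x2).
  assert (Hc : forall n, 0 <= exp_coef n) by (intros; left; apply exp_coef_pos).
  assert (Hrn : forall n, 0 <= r ^ n) by (intros; now apply pow_le).
  apply Rle_trans with (rsum (fun n =>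
      Cmod e1 * (Rabs (x1 ^ n - x2 ^ n) * r ^ n * exp_coef n) +
      Cmod (e1 - e2) * ((r * Rabs x2) ^ n * exp_coef n)) (seq 0 N)).
  - apply rsum_le; intros n.
    rewrite <- !RtoC_pow.
    replace (RtoC (x1 ^ n) * e1 - RtoC (x2 ^ n) * e2)%C
      with (e1 * RtoC (x1 ^ n - x2 ^ n) + (e1 - e2) * RtoC (x2 ^ n))%C
      by (rewrite RtoC_minus; ring).
    rewrite Cmod_mult, Cmod_R, (Rabs_pos_eq (exp_coef n)) by auto.
    assert (Ht := Cmod_triangle (e1 * RtoC (x1 ^ n - x2 ^ n)) ((e1 - e2) * RtoC (x2 ^ n))).
    rewrite !Cmod_mult, !Cmod_R, <- (RPow_abs x2) in Ht.
    rewrite Rpow_mult_distr, Rmult_assoc.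
    eapply Rle_trans; [apply Rmult_le_compat_r; [|exact Ht]|].
    + now apply Rmult_le_pos.
    + right; ring.
  - assert (Hs : forall f g, rsum (fun n : nat => f n + g n) (seq 0 N) =
      rsum f (seq 0 N) + rsum g (seq 0 N)).
    { intros f g; induction (seq 0 N) as [|k l IHl]; simpl; [ring|rewrite IHl; ring]. }
    rewrite Hs, (rsum_scal (fun n => Rabs (x1 ^ n - x2 ^ n) * r ^ n * exp_coef n)),
      (rsum_scal (fun n => (r * Rabs x2) ^ n * exp_coef n)).
    apply Rplus_le_compat; (apply Rmult_le_compat_l; [apply Cmod_ge_0|]).
    2:{ apply exp_partial_sum, Rmult_le_pos; auto. }
    assert (Hf : 0 <= r * Rabs (x1 - x2)) by (apply Rmult_le_pos; auto using Rabs_pos).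
    destruct N as [|N].
    { simpl; apply Rmult_le_pos; [auto|left; apply exp_pos]. }
    (* The term [n = 0] vanishes. After the shift, the factor [n] from the difference of powers
       turns [1/n!] into [1/(n-1)!], and an exponential sum remains. *)
    simpl seq; simpl rsum; rewrite <- seq_shift, rsum_map.
    replace (1 - 1) with 0 by ring; rewrite Rabs_R0, !Rmult_0_l, Rplus_0_l.
    apply Rle_trans with (rsum (fun n => r * Rabs (x1 - x2) * ((r * M) ^ n * exp_coef n))
      (seq 0 N)).
    + apply rsum_le; intros n.
      apply Rle_trans with (INR (S n) * Rabs (x1 - x2) * M ^ n * r ^ S n * exp_coef (S n)).
      * apply Rmult_le_compat_r; [auto|]. apply Rmult_le_compat_r; [auto|].
        now apply pow_diff_le.
      * rewrite Rpow_mult_distr, <- (exp_coef_S n); right; simpl pow; ring.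
    + rewrite (rsum_scal (fun n => (r * M) ^ n * exp_coef n)).
      apply Rmult_le_compat_l; [auto|]. apply exp_partial_sum, Rmult_le_pos; auto.
Qed.

Lemma Rabs_sin_le (x : R) : Rabs (sin x) <= Rabs x.
Proof.
  assert (H : forall y, 0 <= y -> Rabs (sin y) <= y).
  { intros y Hy; destruct (Req_dec y 0) as [->|Hne].
    - rewrite sin_0, Rabs_R0; lra.
    - destruct (SIN_bound y); apply Rabs_le; split.
      + destruct (Rle_dec y PI).
        * generalize (sin_ge_0 y Hy r); lra.
        * generalize PI2_1; lra.
      + left; apply sin_lt_x; lra. }
  destruct (Rle_dec 0 x) as [Hx|Hx].
  - rewrite (Rabs_pos_eq x); auto.
  - rewrite <- (Rabs_Ropp x), <- (Rabs_Ropp (sin x)), <- sin_neg.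
    rewrite (Rabs_pos_eq (- x)) by lra; apply H; lra.
Qed.

(** For [w = x + i y], write [e^w - 1 = e^x (e^(i y) - 1) + (e^x - 1)]. As [x <= 0], the two parts
    are at most [|y|] and [|x|]; the former uses [|e^(i y) - 1| = 2 |sin (y/2)|]. *)
Lemma Cmod_Cexp_sub_1 (w : C) : Re w <= 0 -> Cmod (Cexp w - 1) <= 2 * Cmod w.
Proof.
  destruct w as [x y]; unfold Re; simpl fst; intros Hx.
  assert (E : Cexp (x, y) = (RtoC (exp x) * Cexp (0, y))%C).
  { rewrite <- Cexp_RtoC, <- Cexp_plus; f_equal; apply C_ext; unfold Re, Im; simpl; ring. }
  replace (Cexp (x, y) - 1)%C
    with (RtoC (exp x) * (Cexp (0, y) - 1) + RtoC (exp x - 1))%C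
    by (rewrite E, RtoC_minus; ring).
  eapply Rle_trans; [apply Cmod_triangle|].
  rewrite Cmod_mult, !Cmod_R, (Rabs_pos_eq (exp x)) by (left; apply exp_pos).
  assert (H1 := re_le_Cmod (x, y)); assert (H2 := im_le_Cmod (x, y)).
  unfold Re, Im in H1, H2; simpl fst in H1; simpl snd in H2.
  assert (He : exp x <= 1) by (rewrite <- exp_0; now apply exp_le_compat).
  assert (H3 : Rabs (exp x - 1) <= Rabs x).
  { rewrite !Rabs_left1 by lra; generalize (exp_ineq1_le x); lra. }
  assert (H4 : Cmod (Cexp (0, y) - 1) <= Rabs y).
  { replace (Cexp (0, y) - 1)%C with (RtoC (2 * sin (y / 2)) * (- sin (y / 2), cos (y / 2))%R)%C.
    - rewrite Cmod_mult, Cmod_R.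
      replace (Cmod (- sin (y / 2), cos (y / 2))) with 1.
      + rewrite Rabs_mult, (Rabs_pos_eq 2) by lra.
        assert (H := Rabs_sin_le (y / 2)); unfold Rdiv in H at 2.
        rewrite Rabs_mult, (Rabs_pos_eq (/ 2)) in H by lra; lra.
      + unfold Cmod; simpl.
        replace (- sin (y / 2) * (- sin (y / 2) * 1) + cos (y / 2) * (cos (y / 2) * 1))
          with (Rsqr (sin (y / 2)) + Rsqr (cos (y / 2))) by (unfold Rsqr; ring).
        now rewrite sin2_cos2, sqrt_1.
    - set (t := y / 2); replace y with (2 * t) by (unfold t; field).
      unfold Cexp; apply C_ext; unfold Re, Im; simpl; rewrite exp_0.
      + rewrite cos_2a_sin; ring.
      + rewrite sin_2a; ring. }
  assert (H5 := Cmod_ge_0 (Cexp (0, y) - 1)).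
  assert (H6 := exp_pos x); nra.
Qed.

(** * Summation by parts and power series *)

Lemma is_unordered_sum_unique {T} (f : T -> C) l m :
  is_unordered_sum f l -> is_unordered_sum f m -> l = m.
Proof.
  intros Hl Hm; apply NNPP; intros Hne.
  assert (Hd : 0 < Cmod (l - m)).
  { apply Cmod_gt_0; intros E; apply Hne.
    replace l with (l - m + m)%C by ring; rewrite E; ring. }
  destruct (Hm (pos_div_2 (mkposreal _ Hd))) as [L0 H0].
  destruct (ex_list_sum_close f l L0 (pos_div_2 (mkposreal _ Hd)) Hl)
    as (L & HL & HI & H1).
  specialize (H0 L HL HI); simpl in H0, H1; set (S := list_sum f L) in *.
  assert (E : (l - m = - (S - l) + (S - m))%C) by ring.
  assert (Ht := Cmod_triangle (- (S - l)) (S - m)).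
  rewrite <- E, Cmod_opp in Ht; lra.
Qed.

(** The family [cf i n h^n] over [T x nat] is absolutely summable throughout the disc. Summed along
    [n] first it gives the terms [g h i], hence [S h]; summed along [i] first it gives [a n h^n],
    where [a n] is the sum of [cf i n] over [i]. *)
Lemma is_pseries_unordered_sum {T} (g : C -> T -> C) (cf : T -> nat -> C) (S : C -> C)
    (b : T -> R) (M r : R) :
  0 < r ->
  (forall i N, rsum (fun n => Cmod (cf i n) * r ^ n) (seq 0 N) <= b i) ->
  sums_bounded b M ->
  (forall h i, Cmod h < r ->
    is_series (K := C_AbsRing) (V := C_NormedModule) (fun n => cf i n * h ^ n)%C (g h i)) ->
  (forall h, Cmod h < r -> is_unordered_sum (g h) (S h)) ->
  exists a : nat -> C, forall h, Cmod h < r ->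
    is_pseries (K := C_AbsRing) (V := C_NormedModule) a h (S h).
Proof.
  intros Hr Hb HM Hg HS.
  assert (Hterm : forall i n, 0 <= Cmod (cf i n) * r ^ n).
  { intros; apply Rmult_le_pos; [apply Cmod_ge_0|apply pow_le; lra]. }
  assert (Hbn : forall i, sums_bounded (fun n => Cmod (cf i n) * r ^ n) (b i)).
  { intros i; apply sums_bounded_nat; auto. }
  assert (Hc : forall n, exists l, is_unordered_sum (fun i => cf i n) l).
  { intros n; apply sums_bounded_ex_sum with (/ r ^ n * M).
    apply sums_bounded_le with (fun i => / r ^ n * b i).
    - intros i; assert (H := Hbn i (n :: nil)); simpl in H.
      assert (Hn : 0 < r ^ n) by now apply pow_lt.
      apply Rmult_le_reg_l with (r ^ n); [assumption|].
      rewrite <- Rmult_assoc, Rinv_r, Rmult_1_l, Rmult_comm by lra.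
      rewrite Rplus_0_r in H; apply H.
      constructor; [easy|constructor].
    - apply sums_bounded_scal; [|assumption].
      left; now apply Rinv_0_lt_compat, pow_lt. }
  apply functional_choice in Hc; destruct Hc as [a Ha].
  exists a; intros h Hh.
  set (F := fun x : T * nat => (cf (fst x) (snd x) * h ^ snd x)%C).
  assert (HF : forall i n, Cmod (F (i, n)) <= Cmod (cf i n) * r ^ n).
  { intros i n; unfold F; simpl; rewrite Cmod_mult, Cmod_pow.
    apply Rmult_le_compat_l; [apply Cmod_ge_0|].
    apply pow_incr; split; [apply Cmod_ge_0|lra]. }
  destruct (sums_bounded_ex_sum F M) as [l Hl].
  { apply sums_bounded_prod with b; auto using Cmod_ge_0.
    intros i; apply sums_bounded_le with (2 := Hbn i); intros n; apply HF. }
  assert (Hrow : forall i, is_unordered_sum (fun n => F (i, n)) (g h i)).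
  { intros i.
    destruct (sums_bounded_ex_sum (fun n => F (i, n)) (b i)) as [li Hli].
    - apply sums_bounded_le with (2 := Hbn i); intros n; apply HF.
    - replace (g h i) with li; [assumption|].
      apply is_series_C_unique with (fun n => F (i, n)).
      + now apply is_unordered_sum_series.
      + now apply Hg. }
  replace (S h) with l.
  2:{ apply is_unordered_sum_unique with (g h); auto.
      now apply is_unordered_sum_fubini with F. }
  assert (Hs : is_unordered_sum (fun n => (h ^ n * a n)%C) l).
  { apply is_unordered_sum_fubini with (fun x : nat * T => F (snd x, fst x)).
    - apply (is_unordered_sum_bij F l (fun x => (snd x, fst x)) (fun x => (snd x, fst x)));
        [now intros []|now intros []|assumption].
    - intros n; simpl.
      apply is_unordered_sum_ext with (fun i => (h ^ n * cf i n)%C).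
      + intros i; unfold F; simpl; ring.
      + now apply is_unordered_sum_scal. }
  apply is_unordered_sum_series in Hs.
  unfold is_pseries; eapply is_series_ext; [|exact Hs].
  intros n; simpl.
  assert (E : forall n, pow_n (K := C_Ring) h n = (h ^ n)%C).
  { intros k; induction k as [|k IH]; [reflexivity|].
    rewrite Cpow_S, <- IH; reflexivity. }
  change (h ^ n * a n = pow_n (K := C_Ring) h n * a n)%C; f_equal; symmetry; apply E.
Qed.

Definition lattice_char (alpha beta : R) (i : nat * nat) : C :=
  e2pi (alpha * INR (S (fst i)) + beta * INR (snd i)).

Lemma e2pi_plus (r s : R) : e2pi (r + s) = (e2pi r * e2pi s)%C.
Proof. unfold e2pi; rewrite <- Cexp_plus; f_equal; rewrite RtoC_plus; ring. Qed.

Lemma e2pi_alt (r : R) : e2pi r = (cos (2 * PI * r), sin (2 * PI * r)).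
Proof.
  unfold e2pi, Cexp; replace (2 * PI * r * Ci)%C with (0, 2 * PI * r).
  - unfold Re, Im; simpl; rewrite exp_0; f_equal; ring.
  - apply C_ext; unfold Re, Im; simpl; ring.
Qed.

Lemma Cmod_e2pi (r : R) : Cmod (e2pi r) = 1.
Proof.
  rewrite e2pi_alt; unfold Cmod; simpl.
  rewrite !Rmult_1_r; fold (Rsqr (cos (2 * PI * r))); fold (Rsqr (sin (2 * PI * r))).
  rewrite Rplus_comm, sin2_cos2; apply sqrt_1.
Qed.

Lemma e2pi_INR (r : R) (n : nat) : e2pi (r * INR n) = (e2pi r ^ n)%C.
Proof.
  induction n as [|n IH].
  - rewrite Rmult_0_r, e2pi_alt, Rmult_0_r, cos_0, sin_0; reflexivity.
  - rewrite S_INR, Rmult_plus_distr_l, Rmult_1_r, e2pi_plus, IH, Cpow_S; ring.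
Qed.

Lemma lattice_char_alt alpha beta m q :
  lattice_char alpha beta (m, q) = (e2pi alpha ^ S m * e2pi beta ^ q)%C.
Proof. unfold lattice_char; now rewrite e2pi_plus, !e2pi_INR. Qed.

Lemma Cmod_lattice_char alpha beta i : Cmod (lattice_char alpha beta i) = 1.
Proof. apply Cmod_e2pi. Qed.

Lemma cos_non_integer (r : R) : non_integer r -> cos (2 * PI * r) < 1.
Proof.
  intros Hr; destruct (COS_bound (2 * PI * r)) as [_ [H|H]]; [assumption|].
  exfalso; replace (2 * PI * r) with (2 * (PI * r)) in H by ring.
  rewrite cos_2a_sin in H.
  destruct (sin_eq_0_0 (PI * r)) as [k Hk]; [nra|].
  apply (Hr k); apply Rmult_eq_reg_l with PI; [|generalize PI_RGT_0; lra].
  rewrite Hk; ring.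
Qed.

(* [|1 - rho e(r)|^2 = (1-rho)^2 + 2 rho (1-c) >= (1-c)/2 (1+rho)^2] with
   [c = cos (2 pi r)], because [(1-c)/2 <= 1]. *)
Lemma one_sub_e2pi_lower_bound (r : R) : non_integer r ->
  exists mu, 0 < mu /\
    forall rho, 0 <= rho <= 1 -> mu <= Cmod (1 - RtoC rho * e2pi r).
Proof.
  intros Hr; assert (Hc := cos_non_integer r Hr); rewrite e2pi_alt.
  set (c := cos (2 * PI * r)) in *; set (s := sin (2 * PI * r)).
  assert (Hcs : s * s + c * c = 1) by apply sin2_cos2.
  assert (Hc2 : -1 <= c) by apply COS_bound.
  exists (sqrt ((1 - c) / 2)); split; [apply sqrt_lt_R0; lra|].
  intros rho Hrho; unfold Cmod; apply sqrt_le_1_alt; simpl.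
  match goal with |- _ <= ?e =>
    replace e with ((1 - rho) * (1 - rho) + 2 * rho * (1 - c)
      + rho * rho * (s * s + c * c - 1)) by ring end.
  rewrite Hcs.
  assert (0 <= (1 - (1 - c) / 2) * ((1 - rho) * (1 - rho)))
    by (apply Rmult_le_pos; nra).
  assert (0 <= (1 - c) / 2 * (2 * rho + rho * rho)) by (apply Rmult_le_pos; nra).
  lra.
Qed.

Lemma e2pi_neq_1 (r : R) : non_integer r -> (1 - e2pi r)%C <> 0.
Proof.
  intros Hr; destruct (one_sub_e2pi_lower_bound r Hr) as (mu & Hmu & H).
  specialize (H 1 ltac:(lra)); apply Cmod_gt_0.
  rewrite Cmult_1_l in H; lra.
Qed.

Definition diff_snd (f : nat * nat -> C) (i : nat * nat) : C :=
  match snd i with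
  | O => f i
  | S q => (f i - f (fst i, q))%C
  end.

(** The preimage of [L] under [(m, q) |-> (m, q+1)]; a point on the axis has none. Summing the
    shifted family over [L] is summing [f] over this preimage. *)
Definition unshift_snd (L : list (nat * nat)) : list (nat * nat) :=
  flat_map (fun i => match snd i with O => nil | S q => (fst i, q) :: nil end) L.

Lemma in_unshift_snd m q L : In (m, q) (unshift_snd L) <-> In (m, S q) L.
Proof.
  unfold unshift_snd; rewrite in_flat_map; split.
  - intros ([m' [|q']] & H1 & H2); [destruct H2|destruct H2 as [H2|[]]].
    simpl in H2; congruence.
  - intros H; exists (m, S q); split; [assumption|now left].
Qed.

Lemma is_unordered_sum_shift_snd (f : nat * nat -> C) l :
  is_unordered_sum f l ->
  is_unordered_sum (fun i => match snd i with O => RtoC 0 | S q => f (fst i, q) end) l.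
Proof.
  intros Hf eps; destruct (Hf eps) as [L0 H0].
  exists (map (fun i => (fst i, S (snd i))) L0); intros L HL HI.
  replace (list_sum _ L) with (list_sum f (unshift_snd L)).
  - apply H0.
    + clear HI; induction HL as [|[m [|q]] L Hi HL IH]; [constructor|exact IH|].
      change (NoDup ((m, q) :: unshift_snd L)).
      constructor; [now rewrite in_unshift_snd|exact IH].
    + intros [m q] Hq; apply in_unshift_snd, HI.
      change (m, S q) with ((fun i => (fst i, S (snd i))) (m, q)); now apply in_map.
  - clear; induction L as [|[m [|q]] L IH]; [reflexivity| |].
    + change (list_sum f (unshift_snd L) = 0 + list_sum
        (fun i => match snd i with O => RtoC 0 | S q => f (fst i, q) end) L)%C.
      rewrite IH; ring.
    + change (f (m, q) + list_sum f (unshift_snd L) = f (m, q) + list_sum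
        (fun i => match snd i with O => RtoC 0 | S q => f (fst i, q) end) L)%C.
      now rewrite IH.
Qed.

(** Multiplication by [e2pi beta] moves the character from [(m, q)] to [(m, q+1)], so [e2pi beta]
    times the sum is the sum of the family shifted by one in [q]. Here the original series is
    assumed to converge; this is the link that makes the transformed sum a continuation. *)
Lemma is_unordered_sum_diff_snd alpha beta (f : nat * nat -> C) l :
  is_unordered_sum (fun i => lattice_char alpha beta i * f i)%C l ->
  is_unordered_sum (fun i => lattice_char alpha beta i * diff_snd f i)%C
    ((1 - e2pi beta) * l)%C.
Proof.
  intros Hf.
  replace ((1 - e2pi beta) * l)%C with (l - e2pi beta * l)%C by ring.
  eapply is_unordered_sum_ext;
    [|apply is_unordered_sum_minus; [exact Hf|
      apply is_unordered_sum_scal, is_unordered_sum_shift_snd, Hf]].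
  intros [m [|q]]; unfold diff_snd; simpl fst; simpl snd; cbv beta iota.
  - ring.
  - rewrite !lattice_char_alt, (Cpow_S (e2pi beta)); ring.
Qed.

(** * The Dirichlet series of the form *)

Definition bqf_ln (Q : bqf) (i : nat * nat) : R :=
  ln (bqf_eval Q (INR (S (fst i))) (INR (snd i))).

Definition bqf_term (Q : bqf) (s : C) (i : nat * nat) : C :=
  Cexp (- (s * RtoC (bqf_ln Q i))).

(** Coefficientwise comparison with [k (p+q)^2], where [k] is the least of [a], [b/2], [c]. The
    factor 1/4 pays for replacing [p + q] by [p + q + 1 <= 2 (p+q)], so that both ends of a
    difference in [q] can be measured by the same norm. *)
Lemma bqf_lower_bound Q : 0 < qa Q -> 0 < qb Q -> 0 < qc Q ->
  exists k, 0 < k /\ forall m q,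
    k * lattice_norm m q ^ 2 <= bqf_eval Q (INR (S m)) (INR q) /\
    k * lattice_norm m (S q) ^ 2 <= bqf_eval Q (INR (S m)) (INR q).
Proof.
  destruct Q as [a b c]; unfold bqf_eval, lattice_norm; simpl qa; simpl qb; simpl qc.
  intros Ha Hb Hc.
  set (k := Rmin a (Rmin (b / 2) c)).
  assert (Hk : 0 < k) by (unfold k; repeat apply Rmin_pos; lra).
  assert (H1 : k <= a) by apply Rmin_l.
  assert (H2 : k <= b / 2) by (eapply Rle_trans; [apply Rmin_r|apply Rmin_l]).
  assert (H3 : k <= c) by (eapply Rle_trans; [apply Rmin_r|apply Rmin_r]).
  exists (k / 4); split; [lra|]; intros m q.
  rewrite (S_INR q).
  assert (Hp : 1 <= INR (S m)) by (rewrite S_INR; generalize (pos_INR m); lra).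
  assert (Hq := pos_INR q).
  set (p := INR (S m)) in *; set (y := INR q) in *.
  assert (H : k * (p + y) ^ 2 <= a * p ^ 2 + b * p * y + c * y ^ 2).
  { assert (0 <= (a - k) * p ^ 2) by (apply Rmult_le_pos; nra).
    assert (0 <= (b - 2 * k) * (p * y)) by (apply Rmult_le_pos; nra).
    assert (0 <= (c - k) * y ^ 2) by (apply Rmult_le_pos; nra).
    nra. }
  split.
  - assert (0 <= k * (p + y) ^ 2) by (apply Rmult_le_pos; nra). lra.
  - apply Rle_trans with (2 := H).
    replace (k / 4 * (p + (y + 1)) ^ 2) with (k * ((p + y + 1) / 2) ^ 2) by field.
    apply Rmult_le_compat_l; [lra|]. apply pow_incr; lra.
Qed.

(** The last bound is the gain of one power of the norm. By [ln u <= u - 1], the difference of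
    logarithms is at most [(Q1 - Q2)/Q2]. With [n = p + q + 1], the numerator [b p + c (2q + 1)] is
    at most [(b + 2c) n] and the denominator is at least [k n^2]. *)
Lemma bqf_ln_bounds Q : 0 < qa Q -> 0 < qb Q -> 0 < qc Q ->
  exists l K, 0 <= K /\
    (forall m q, l + 2 * ln (lattice_norm m q) <= bqf_ln Q (m, q)) /\
    (forall m q, l + 2 * ln (lattice_norm m (S q)) <= bqf_ln Q (m, q) /\
      0 <= bqf_ln Q (m, S q) - bqf_ln Q (m, q) <=
      K * exp (- ln (lattice_norm m (S q)))).
Proof.
  intros Ha Hb Hc.
  destruct (bqf_lower_bound Q Ha Hb Hc) as (k & Hk & Hl).
  exists (ln k), ((qb Q + 2 * qc Q) / k).
  assert (HN : forall m q, 0 < lattice_norm m q)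
    by (intros; generalize (lattice_norm_ge_1 m q); lra).
  assert (HN2 : forall m q, 0 < k * lattice_norm m q ^ 2).
  { intros; apply Rmult_lt_0_compat, pow_lt; auto. }
  assert (Hln : forall m q, ln (k * lattice_norm m q ^ 2) = ln k + 2 * ln (lattice_norm m q)).
  { intros m q; rewrite ln_mult, ln_pow by (try apply pow_lt; auto); simpl; ring. }
  repeat split.
  - apply Rlt_le, Rdiv_lt_0_compat; lra.
  - intros m q; rewrite <- Hln; apply ln_le; [apply HN2|apply Hl].
  - rewrite <- Hln; apply ln_le; [apply HN2|apply Hl].
  - unfold bqf_ln; simpl fst; simpl snd.
    match goal with |- 0 <= ?a - ?b => cut (b <= a); [lra|] end; apply ln_le.
    + apply Rlt_le_trans with (1 := HN2 m q), Hl.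
    + unfold bqf_eval; simpl fst; simpl snd; rewrite (S_INR q).
      generalize (INR_S_pos m) (pos_INR q); intros H1 H2.
      assert (0 < qb Q * INR (S m)) by now apply Rmult_lt_0_compat.
      assert (0 <= qc Q * INR q) by (apply Rmult_le_pos; lra).
      nra.
  - destruct (Hl m q) as [_ H2]; specialize (HN2 m (S q)); specialize (HN m (S q)).
    rewrite exp_Ropp, exp_ln by assumption.
    unfold bqf_ln; simpl fst; simpl snd.
    set (Q1 := bqf_eval Q (INR (S m)) (INR (S q))).
    set (Q2 := bqf_eval Q (INR (S m)) (INR q)) in *.
    set (n := lattice_norm m (S q)) in *.
    assert (H3 : 0 <= Q1 - Q2 <= (qb Q + 2 * qc Q) * n).
    { unfold Q1, Q2, n, bqf_eval, lattice_norm; rewrite (S_INR q).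
      generalize (INR_S_pos m) (pos_INR q); intros H3 H4.
      assert (0 < qb Q * INR (S m)) by now apply Rmult_lt_0_compat.
      assert (0 <= qc Q * INR q) by (apply Rmult_le_pos; lra).
      assert (0 <= qb Q * INR q) by (apply Rmult_le_pos; lra).
      assert (0 < qc Q * INR (S m)) by now apply Rmult_lt_0_compat.
      split; nra. }
    assert (HQ2 : 0 < Q2) by lra.
    assert (H4 := ln_le_sub_1 (Q1 / Q2) ltac:(apply Rdiv_lt_0_compat; lra)).
    unfold Rdiv in H4; rewrite ln_mult, ln_Rinv in H4; try lra;
      [|apply Rinv_0_lt_compat; lra].
    replace (Q1 * / Q2 - 1) with ((Q1 - Q2) / Q2) in H4 by (field; lra).
    apply Rle_trans with ((Q1 - Q2) / Q2); [lra|].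
    apply Rle_trans with (((qb Q + 2 * qc Q) * n) / (k * n ^ 2)).
    + apply Rmult_le_compat; try lra.
      * left; apply Rinv_0_lt_compat; lra.
      * apply Rinv_le_contravar; lra.
    + right; field; lra.
Qed.

Lemma Rabs_le_shift (x l : R) : - Rabs l <= x -> Rabs x <= x + 2 * Rabs l.
Proof.
  intros H; generalize (Rabs_pos l); intros Hl.
  apply Rabs_le; lra.
Qed.

(** The coefficient of [h^n] in the transformed term at [s = z0 + h]. *)
Definition bqf_coef (Q : bqf) (alpha beta : R) (z0 : C) (i : nat * nat) (n : nat) : C :=
  (lattice_char alpha beta i *
   (diff_snd (fun j => RtoC (- bqf_ln Q j) ^ n * bqf_term Q z0 j) i * RtoC (exp_coef n)))%C.

Lemma Cmod_bqf_term Q s i : Cmod (bqf_term Q s i) = exp (- (Re s * bqf_ln Q i)).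
Proof.
  unfold bqf_term; rewrite Cmod_Cexp; f_equal.
  unfold Re; simpl; ring.
Qed.

(** The worst real part in the disc of radius [r] is [tau = Re z0 - r], and the weighted
    coefficients behave like the term at [tau]. With [n] the norm of the point, the axis gives
    [n^(-2 tau)]; elsewhere the difference contributes a further [1/n]. *)
Lemma bqf_coef_bound Q alpha beta (z0 : C) (r : R) :
  0 < qa Q -> 0 < qb Q -> 0 < qc Q -> 0 <= r -> 1 / 2 < Re z0 - r ->
  exists K, 0 <= K /\ forall i N,
    rsum (fun n => Cmod (bqf_coef Q alpha beta z0 i n) * r ^ n) (seq 0 N) <=
    K * zeta2_term (Re z0 - r - 1 / 2) i.
Proof.
  intros Ha Hb Hc Hr Htau.
  destruct (bqf_ln_bounds Q Ha Hb Hc) as (l & K & HK & Hlow & Hdiff).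
  set (tau := Re z0 - r) in *; set (D := Rabs l).
  (* [bqf_ln] may be negative. The factor [e^(2 r D)] pays for replacing [|y|] by [y + 2 D], and
     [e^(- tau l)] comes from the lower bound [l + 2 Lam <= y]. *)
  set (X := exp (2 * r * D - tau * l)).
  assert (HX : 0 < X) by apply exp_pos.
  assert (Hz := Cmod_ge_0 z0).
  assert (HrK : 0 <= (r + 2 * Cmod z0) * K) by (apply Rmult_le_pos; lra).
  assert (HB : forall Lam y, 0 <= Lam -> l + 2 * Lam <= y -> Rabs y <= y + 2 * D /\
     exp (- (Re z0 * y)) * exp (r * (y + 2 * D)) <= X * exp (- (2 * tau) * Lam)).
  { intros Lam y HLam Hy; split.
    - apply Rabs_le_shift; unfold D; generalize (Rabs_left1 l) (Rle_abs l) (Rabs_pos l).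
      destruct (Rle_dec l 0); intros; [rewrite H by assumption|]; lra.
    - unfold X; rewrite <- !exp_plus; apply exp_le_compat.
      replace (Re z0) with (tau + r) by (unfold tau; ring).
      assert (tau * (l + 2 * Lam) <= tau * y) by (apply Rmult_le_compat_l; lra).
      lra. }
  exists (X * (1 + (r + 2 * Cmod z0) * K)); split; [apply Rmult_le_pos; lra|].
  intros [m [|q]] N.
  - specialize (Hlow m 0%nat); destruct (ln_lattice_norm m 0) as [[H0 H1] _].
    destruct (HB (ln (lattice_norm m 0)) (bqf_ln Q (m, 0%nat)) ltac:(lra) Hlow)
      as [H2 H3].
    set (L := bqf_ln Q (m, 0%nat)) in *; set (Lam := ln (lattice_norm m 0)) in *.
    (* With equal exponents and [e2 = 0], the estimate for a difference becomes one for a single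
       term. *)
    assert (E := coef_diff_le (- L) (- L) (L + 2 * D) r (bqf_term Q z0 (m, 0%nat)) 0 N).
    rewrite !Rabs_Ropp in E; specialize (E H2 H2 Hr).
    replace (- L - - L) with 0 in E by ring; rewrite Rabs_R0 in E.
    replace (bqf_term Q z0 (m, 0%nat) - 0)%C with (bqf_term Q z0 (m, 0%nat)) in E by ring.
    rewrite Cmod_bqf_term in E; fold L in E.
    erewrite rsum_ext; [eapply Rle_trans; [exact E|]|].
    2:{ intros n; unfold bqf_coef; rewrite (Cmod_mult (lattice_char _ _ _)), Cmod_lattice_char, Rmult_1_l.
        unfold diff_snd; simpl snd; cbv iota; fold L.
        do 3 f_equal; ring. }
    apply Rle_trans with (X * exp (- (2 * tau) * Lam)).
    + apply Rle_trans with (2 := H3); rewrite Rmult_0_r, Rmult_0_l, Rmult_0_r, Rplus_0_l.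
      apply Rmult_le_compat_l; [left; apply exp_pos|].
      apply exp_le_compat, Rmult_le_compat_l; assumption.
    + assert (H4 := axis_le_zeta2 (tau - 1 / 2) m ltac:(lra)).
      replace (- (1 + 2 * (tau - 1 / 2))) with (- (2 * tau)) in H4 by field.
      fold Lam in H4.
      assert (H5 := exp_pos (- (2 * tau) * Lam)).
      apply Rmult_le_compat; [lra|lra| |exact H4].
      rewrite <- (Rmult_1_r X) at 1; apply Rmult_le_compat_l; lra.
  - destruct (Hdiff m q) as [Hl2 [Hd0 Hd]]; specialize (Hlow m (S q)).
    destruct (ln_lattice_norm m (S q)) as [[H0 H1] _].
    destruct (HB (ln (lattice_norm m (S q))) _ ltac:(lra) Hlow) as [H2 H3].
    destruct (HB (ln (lattice_norm m (S q))) _ ltac:(lra) Hl2) as [H4 H5].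
    set (L1 := bqf_ln Q (m, S q)) in *; set (L2 := bqf_ln Q (m, q)) in *.
    set (Lam := ln (lattice_norm m (S q))) in *.
    assert (E := coef_diff_le (- L1) (- L2) (L1 + 2 * D) r
      (bqf_term Q z0 (m, S q)) (bqf_term Q z0 (m, q)) N).
    rewrite !Rabs_Ropp in E; specialize (E H2 ltac:(lra) Hr).
    replace (- L1 - - L2) with (- (L1 - L2)) in E by ring.
    rewrite Rabs_Ropp, (Rabs_pos_eq (L1 - L2)) in E by assumption.
    (* The term at [q] is factored out: since [L1 >= L2] and [Re z0 > 0], the remaining exponent has
       nonpositive real part. *)
    assert (Ed : Cmod (bqf_term Q z0 (m, S q) - bqf_term Q z0 (m, q)) <=
      exp (- (Re z0 * L2)) * (2 * Cmod z0 * (L1 - L2))).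
    { replace (bqf_term Q z0 (m, S q) - bqf_term Q z0 (m, q))%C
        with (bqf_term Q z0 (m, q) * (Cexp (- (z0 * RtoC (L1 - L2))) - 1))%C.
      - rewrite Cmod_mult, Cmod_bqf_term; fold L2.
        apply Rmult_le_compat_l; [left; apply exp_pos|].
        eapply Rle_trans; [apply Cmod_Cexp_sub_1|].
        + unfold Re; simpl; fold (Re z0).
          assert (0 <= Re z0 * (L1 - L2)) by (apply Rmult_le_pos; unfold tau in *; lra).
          lra.
        + rewrite Cmod_opp, Cmod_mult, Cmod_R, Rabs_pos_eq by assumption; lra.
      - replace (bqf_term Q z0 (m, S q)) with
          (bqf_term Q z0 (m, q) * Cexp (- (z0 * RtoC (L1 - L2))))%C; [ring|].
        unfold bqf_term; fold L1 L2; rewrite <- Cexp_plus; f_equal.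
        rewrite RtoC_minus; ring. }
    erewrite rsum_ext; [eapply Rle_trans; [exact E|]|].
    2:{ intros n; unfold bqf_coef; rewrite (Cmod_mult (lattice_char _ _ _)), Cmod_lattice_char, Rmult_1_l.
        reflexivity. }
    rewrite Cmod_bqf_term; fold L1.
    set (Y := X * exp (- (2 * tau) * Lam)) in *.
    assert (H6 : exp (- (Re z0 * L2)) * exp (r * Rabs L2) <= Y).
    { apply Rle_trans with (2 := H5), Rmult_le_compat_l; [left; apply exp_pos|].
      now apply exp_le_compat, Rmult_le_compat_l. }
    assert (HY : 0 < Y) by (apply Rmult_lt_0_compat; [assumption|apply exp_pos]).
    apply Rle_trans with (Y * ((r + 2 * Cmod z0) * (L1 - L2))).
    + assert (0 <= r * (L1 - L2)) by now apply Rmult_le_pos.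
      assert (0 <= 2 * Cmod z0 * (L1 - L2)) by (apply Rmult_le_pos; lra).
      assert (P1 : exp (- (Re z0 * L1)) * exp (r * (L1 + 2 * D)) * (r * (L1 - L2)) <=
        Y * (r * (L1 - L2))) by now apply Rmult_le_compat_r.
      assert (P2 : exp (- (Re z0 * L2)) * exp (r * Rabs L2) * (2 * Cmod z0 * (L1 - L2)) <=
        Y * (2 * Cmod z0 * (L1 - L2))) by now apply Rmult_le_compat_r.
      assert (P3 := Rmult_le_compat_r _ _ _
        (Rlt_le _ _ (exp_pos (r * Rabs L2))) Ed).
      lra.
    + apply Rle_trans with (Y * ((r + 2 * Cmod z0) * K * exp (- Lam))).
      { apply Rmult_le_compat_l; [lra|].
        rewrite Rmult_assoc; apply Rmult_le_compat_l; lra. }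
      (* The exponent is [2 tau + 1]: [2 tau] from the size of the terms and 1 from the
         difference. *)
      assert (H7 := lattice_norm_le_zeta2 (tau - 1 / 2) m (S q) ltac:(lra)).
      fold Lam in H7.
      replace (- (2 * (1 + (tau - 1 / 2))) * Lam) with (- (2 * tau) * Lam + - Lam) in H7 by field.
      rewrite exp_plus in H7; unfold Y.
      set (W := exp (- (2 * tau) * Lam) * exp (- Lam)) in *.
      assert (HW : 0 < W) by (apply Rmult_lt_0_compat; apply exp_pos).
      replace (X * exp (- (2 * tau) * Lam) * ((r + 2 * Cmod z0) * K * exp (- Lam)))
        with (X * ((r + 2 * Cmod z0) * K) * W) by (unfold W; ring).
      apply Rmult_le_compat; [apply Rmult_le_pos; lra|lra| |exact H7].
      apply Rmult_le_compat_l; lra.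
Qed.

Lemma bqf_coef_series Q alpha beta z0 h i :
  is_series (K := C_AbsRing) (V := C_NormedModule)
    (fun n => bqf_coef Q alpha beta z0 i n * h ^ n)%C
    (lattice_char alpha beta i * diff_snd (bqf_term Q (z0 + h)) i)%C.
Proof.
  assert (H1 : forall j, is_series (K := C_AbsRing) (V := C_NormedModule)
    (fun n => (RtoC (- bqf_ln Q j) ^ n * bqf_term Q z0 j) * RtoC (exp_coef n) * h ^ n)%C
    (bqf_term Q (z0 + h) j)).
  { intros j; replace (bqf_term Q (z0 + h) j)
      with (bqf_term Q z0 j * Cexp (RtoC (- bqf_ln Q j) * h))%C.
    - eapply is_series_ext; [|apply (is_series_scal (K := C_AbsRing) (V := C_NormedModule)
        (bqf_term Q z0 j) _ _ (is_series_Cexp (RtoC (- bqf_ln Q j) * h)))].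
      intros n; change (bqf_term Q z0 j * ((RtoC (- bqf_ln Q j) * h) ^ n * RtoC (exp_coef n)) =
        (RtoC (- bqf_ln Q j) ^ n * bqf_term Q z0 j) * RtoC (exp_coef n) * h ^ n)%C.
      rewrite Cpow_mult_l; ring.
    - unfold bqf_term; rewrite <- Cexp_plus; f_equal; rewrite RtoC_opp; ring. }
  assert (H2 : is_series (K := C_AbsRing) (V := C_NormedModule)
    (fun n => diff_snd (fun j => RtoC (- bqf_ln Q j) ^ n * bqf_term Q z0 j) i
       * RtoC (exp_coef n) * h ^ n)%C (diff_snd (bqf_term Q (z0 + h)) i)).
  { destruct i as [m [|q]]; unfold diff_snd; simpl fst; simpl snd; cbv iota.
    - apply H1.
    - eapply is_series_ext;
        [|apply (is_series_minus (K := C_AbsRing) (V := C_NormedModule) _ _ _ _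
            (H1 (m, S q)) (H1 (m, q)))].
      intros n; cbv beta.
      match goal with |- plus ?a (opp ?b) = ?c => change (@eq C (a - b)%C c) end.
      ring. }
  eapply is_series_ext; [|apply (is_series_scal (K := C_AbsRing) (V := C_NormedModule)
    (lattice_char alpha beta i) _ _ H2)].
  intros n; unfold bqf_coef; cbv beta.
  match goal with |- scal ?a ?b = ?c => change (@eq C (a * b)%C c) end; ring.
Qed.

(** * Improper integrals of complex functions *)

Lemma is_RInt_exp_decay (lam a b : R) : lam <> 0 ->
  is_RInt (fun t => exp (- (lam * t))) a b ((exp (- (lam * a)) - exp (- (lam * b))) / lam).
Proof.
  intros Hl.
  replace ((exp (- (lam * a)) - exp (- (lam * b))) / lam)
    with (minus (- exp (- (lam * b)) / lam) (- exp (- (lam * a)) / lam))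
    by (unfold minus, plus, opp; simpl; field; assumption).
  apply (is_RInt_derive (fun t => - exp (- (lam * t)) / lam)).
  - intros t _; auto_derive; [trivial|field; assumption].
  - intros t _; apply (ex_derive_continuous (fun t => exp (- (lam * t)))).
    now auto_derive.
Qed.

Lemma is_RInt_C_exp_decay (c : C) (lam a b : R) : lam <> 0 ->
  is_RInt (V := C_R_NormedModule) (fun t => c * RtoC (exp (- (lam * t))))%C a b
    (c * RtoC ((exp (- (lam * a)) - exp (- (lam * b))) / lam))%C.
Proof.
  intros Hl; assert (H := is_RInt_exp_decay lam a b Hl).
  destruct c as [u v].
  set (I := (exp (- (lam * a)) - exp (- (lam * b))) / lam) in *.
  replace ((u, v) * RtoC I)%C with (scal u I, scal v I)
    by (apply C_ext; unfold Re, Im, scal; simpl; unfold mult; simpl; ring).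
  apply (is_RInt_fct_extend_pair (U := R_NormedModule) (V := R_NormedModule)).
  - eapply is_RInt_ext; [|apply (is_RInt_scal _ _ _ u _ H)].
    intros t _; unfold scal; simpl; unfold mult; simpl; ring.
  - eapply is_RInt_ext; [|apply (is_RInt_scal _ _ _ v _ H)].
    intros t _; unfold scal; simpl; unfold mult; simpl; ring.
Qed.

Lemma norm_C_R (z : C) : norm (V := C_R_NormedModule) z = Cmod z.
Proof. symmetry; apply Cmod_norm. Qed.

(** Turns the limit along the product filter into an estimate in [Cmod], which is the norm of [C] as
    a real product space. *)
Lemma is_RInt_gen_C_iff (f : R -> C) (l : C) :
  is_RInt_gen (V := C_R_NormedModule) f (at_right 0) (Rbar_locally p_infty) l <->
  forall eps : posreal, filter_prod (at_right 0) (Rbar_locally p_infty)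
    (fun ab => exists y : C, is_RInt (V := C_R_NormedModule) f (fst ab) (snd ab) y /\
      Cmod (y - l) < eps).
Proof.
  split.
  - intros H eps; apply (H (fun y : C => Cmod (y - l) < eps)).
    apply filter_imp with (2 := locally_ball_norm (V := C_R_NormedModule) l eps).
    intros y Hy; rewrite <- norm_C_R; exact Hy.
  - intros H P HP.
    destruct (locally_norm_le_locally (V := C_R_NormedModule) l P HP) as [eps Heps].
    apply filter_imp with (2 := H eps).
    intros ab (y & Hy & Hd); exists y; split; [exact Hy|].
    apply Heps; unfold ball_norm; rewrite norm_C_R; exact Hd.
Qed.

Lemma filter_prod_pos_lt :
  filter_prod (at_right 0) (Rbar_locally p_infty) (fun ab : R * R => 0 < fst ab < snd ab).
Proof.
  exists (fun a => 0 < a < 1) (fun b => 1 < b).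
  - exists (mkposreal 1 Rlt_0_1); intros a Ha Hpos; split; [assumption|].
    unfold ball in Ha; simpl in Ha; unfold AbsRing_ball, abs, minus, plus, opp in Ha;
    simpl in Ha; apply Rabs_def2 in Ha; lra.
  - now exists 1.
  - intros a b; simpl; lra.
Qed.

Lemma is_RInt_gen_C_exp_decay (c : C) (lam : R) : 0 < lam ->
  is_RInt_gen (V := C_R_NormedModule) (fun t => c * RtoC (exp (- (lam * t))))%C
    (at_right 0) (Rbar_locally p_infty) (c * RtoC (/ lam))%C.
Proof.
  intros Hl; apply is_RInt_gen_C_iff; intros eps.
  assert (Hc := Cmod_ge_0 c).
  (* Each end of the interval costs at most [d/lam]: [a < d/lam] gives [e^(- lam a) > 1 - d], and
     [b > 1/(d lam)] gives [e^(- lam b) < d]. The [+ 1] covers the case [c = 0]. *)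
  set (d := eps * lam / (2 * (Cmod c + 1))).
  assert (Hd : 0 < d).
  { apply Rdiv_lt_0_compat; [|lra]. apply Rmult_lt_0_compat; [apply cond_pos|lra]. }
  exists (fun a => 0 < a < d / lam) (fun b => / (d * lam) < b).
  - assert (Hdl : 0 < d / lam) by now apply Rdiv_lt_0_compat.
    exists (mkposreal _ Hdl); intros a Ha Hpos; split; [assumption|].
    unfold ball in Ha; simpl in Ha; unfold AbsRing_ball, abs, minus, plus, opp in Ha;
    simpl in Ha; apply Rabs_def2 in Ha; lra.
  - now exists (/ (d * lam)).
  - intros a b [Ha0 Ha] Hb; simpl fst; simpl snd.
    eexists; split; [apply is_RInt_C_exp_decay; lra|].
    set (e1 := exp (- (lam * a))); set (e2 := exp (- (lam * b))).
    replace (c * RtoC ((e1 - e2) / lam) - c * RtoC (/ lam))%C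
      with (c * RtoC ((e1 - 1 - e2) / lam))%C.
    2:{ replace ((e1 - 1 - e2) / lam) with ((e1 - e2) / lam - / lam) by (field; lra).
        rewrite RtoC_minus; ring. }
    rewrite Cmod_mult, Cmod_R.
    assert (H1 : 1 - d < e1 <= 1).
    { unfold e1; split.
      - apply Rlt_le_trans with (1 + - (lam * a)); [|apply exp_ineq1_le].
        apply Rmult_lt_compat_l with (r := lam) in Ha; [|lra].
        replace (lam * (d / lam)) with d in Ha by (field; lra); lra.
      - rewrite <- exp_0; apply exp_le_compat.
        assert (0 < lam * a) by now apply Rmult_lt_0_compat. lra. }
    assert (H2 : 0 < e2 < d).
    { unfold e2; split; [apply exp_pos|].
      assert (Hdl : 0 < d * lam) by now apply Rmult_lt_0_compat.
      apply Rmult_lt_compat_l with (r := lam) in Hb; [|lra].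
      replace (lam * / (d * lam)) with (/ d) in Hb by (field; lra).
      assert (H3 := exp_ineq1_le (lam * b)).
      rewrite exp_Ropp, <- (Rinv_inv d); apply Rinv_lt_contravar; [|lra].
      apply Rmult_lt_0_compat; [now apply Rinv_0_lt_compat|apply exp_pos]. }
    assert (H3 : Rabs ((e1 - 1 - e2) / lam) <= 2 * d / lam).
    { unfold Rdiv; rewrite Rabs_mult, (Rabs_pos_eq (/ lam))
        by (left; now apply Rinv_0_lt_compat).
      apply Rmult_le_compat_r; [left; now apply Rinv_0_lt_compat|].
      apply Rabs_le; lra. }
    apply Rle_lt_trans with (Cmod c * (2 * d / lam)).
    + now apply Rmult_le_compat_l.
    + replace (2 * d / lam) with (eps / (Cmod c + 1)) by (unfold d; field; lra).
      apply Rmult_lt_reg_r with (Cmod c + 1); [lra|].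
      replace (Cmod c * (eps / (Cmod c + 1)) * (Cmod c + 1)) with (Cmod c * eps)
        by (field; lra).
      generalize (cond_pos eps); nra.
Qed.

Lemma is_RInt_gen_list_sum_exp_decay {T} (c : T -> C) (lam : T -> R) (L : list T) :
  (forall i, 0 < lam i) ->
  is_RInt_gen (V := C_R_NormedModule)
    (fun t => list_sum (fun i => c i * RtoC (exp (- (lam i * t))))%C L)
    (at_right 0) (Rbar_locally p_infty) (list_sum (fun i => c i * RtoC (/ lam i))%C L).
Proof.
  intros Hl; induction L as [|i L IH]; simpl.
  - assert (H := is_RInt_gen_C_exp_decay 0 1 Rlt_0_1).
    rewrite Cmult_0_l in H.
    eapply is_RInt_gen_ext; [|exact H].
    apply filter_forall; intros ab t _; apply Cmult_0_l.
  - apply (is_RInt_gen_plus (V := C_R_NormedModule) (fun t => c i * RtoC (exp (- (lam i * t))))%C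
      (fun t => list_sum (fun i => c i * RtoC (exp (- (lam i * t))))%C L)).
    + now apply is_RInt_gen_C_exp_decay.
    + exact IH.
Qed.

(** A substitute for dominated convergence: the improper integral of [g] is known, and the integrals
    of the majorant [rho] stay below [eps] uniformly in the interval. The error splits into [f]
    against [g] on [[a, b]], [g] on [[a, b]] against [v], and [v] against [l]. *)
Lemma is_RInt_gen_approx (f : R -> C) (l : C) :
  (forall a b, 0 < a < b -> ex_RInt (V := C_R_NormedModule) f a b) ->
  (forall eps : posreal, exists (g : R -> C) (v : C) (rho : R -> R),
    is_RInt_gen (V := C_R_NormedModule) g (at_right 0) (Rbar_locally p_infty) v /\
    Cmod (v - l) < eps /\
    (forall t, 0 < t -> Cmod (f t - g t) <= rho t) /\
    (forall a b, 0 < a < b -> exists k, is_RInt rho a b k /\ k < eps)) ->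
  is_RInt_gen (V := C_R_NormedModule) f (at_right 0) (Rbar_locally p_infty) l.
Proof.
  intros Hf H; apply is_RInt_gen_C_iff; intros eps.
  assert (He : 0 < eps / 3) by (generalize (cond_pos eps); lra).
  destruct (H (mkposreal _ He)) as (g & v & rho & Hg & Hv & Hfg & Hrho).
  assert (Hg' := proj1 (is_RInt_gen_C_iff g v) Hg (mkposreal _ He)).
  apply filter_imp with (2 := filter_and _ _ filter_prod_pos_lt Hg').
  intros [a b] [Hab (y & Hy & Hyv)]; simpl fst in *; simpl snd in *; simpl pos in *.
  destruct (Hf a b Hab) as [yf Hyf]; exists yf; split; [exact Hyf|].
  destruct (Hrho a b Hab) as (k & Hk & Hke).
  assert (Hd : Cmod (yf - y) <= k).
  { rewrite <- norm_C_R.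
    apply (norm_RInt_le (V := C_R_NormedModule) (fun t => f t - g t)%C rho a b (yf - y)%C k).
    - lra.
    - intros t Ht; rewrite norm_C_R; apply Hfg; lra.
    - apply (is_RInt_minus (V := C_R_NormedModule) f g a b yf y Hyf Hy).
    - exact Hk. }
  replace (yf - l)%C with ((yf - y) + ((y - v) + (v - l)))%C by ring.
  eapply Rle_lt_trans; [apply Cmod_triangle|].
  assert (Ht := Cmod_triangle (y - v) (v - l)); lra.
Qed.

(** * Componentwise continuity, as the source of integrability on compact intervals *)

Definition C_continuous (f : R -> C) (t : R) : Prop :=
  continuous (fun s => Re (f s)) t /\ continuous (fun s => Im (f s)) t.

Lemma ex_RInt_C_continuous (f : R -> C) (a b : R) :
  (forall t, Rmin a b <= t <= Rmax a b -> C_continuous f t) ->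
  ex_RInt (V := C_R_NormedModule) f a b.
Proof.
  intros H.
  apply (ex_RInt_fct_extend_pair (U := R_NormedModule) (V := R_NormedModule)).
  - apply (ex_RInt_continuous (V := R_CompleteNormedModule)); intros t Ht; apply (H t Ht).
  - apply (ex_RInt_continuous (V := R_CompleteNormedModule)); intros t Ht; apply (H t Ht).
Qed.

Lemma C_continuous_plus (f g : R -> C) t :
  C_continuous f t -> C_continuous g t -> C_continuous (fun s => f s + g s)%C t.
Proof.
  intros [H1 H2] [H3 H4]; split.
  - exact (continuous_plus _ _ _ H1 H3).
  - exact (continuous_plus _ _ _ H2 H4).
Qed.

Lemma C_continuous_mult (f g : R -> C) t :
  C_continuous f t -> C_continuous g t -> C_continuous (fun s => f s * g s)%C t.
Proof.
  intros [H1 H2] [H3 H4]; split.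
  - exact (continuous_minus _ _ _ (continuous_mult _ _ _ H1 H3) (continuous_mult _ _ _ H2 H4)).
  - exact (continuous_plus _ _ _ (continuous_mult _ _ _ H1 H4) (continuous_mult _ _ _ H2 H3)).
Qed.

Lemma C_continuous_const (c : C) t : C_continuous (fun _ => c) t.
Proof. split; apply continuous_const. Qed.

Lemma C_continuous_exp_decay (lam : R) t :
  C_continuous (fun s => RtoC (exp (- (lam * s)))) t.
Proof.
  split; [|apply continuous_const].
  apply (ex_derive_continuous (fun t => exp (- (lam * t)))); now auto_derive.
Qed.

Lemma C_continuous_pow (f : R -> C) n t :
  C_continuous f t -> C_continuous (fun s => f s ^ n)%C t.
Proof.
  intros Hf; induction n as [|n IH].
  - apply C_continuous_const.
  - apply (C_continuous_mult f (fun s => f s ^ n)%C); assumption.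
Qed.

Lemma C_continuous_inv (f : R -> C) t :
  f t <> 0 -> C_continuous f t -> C_continuous (fun s => / f s)%C t.
Proof.
  intros Hne [H1 H2].
  assert (Hn : (Re (f t)) ^ 2 + (Im (f t)) ^ 2 <> 0).
  { intros E; apply Hne, C_ext; simpl; nra. }
  assert (Hc : continuous (fun s => / (Re (f s) ^ 2 + Im (f s) ^ 2)) t).
  { apply continuous_Rinv_comp; [|exact Hn].
    assert (Hsq : forall u : R -> R, continuous u t -> continuous (fun s => u s ^ 2) t).
    { intros u Hu; exact (continuous_mult _ _ _ Hu
        (continuous_mult _ _ _ Hu (continuous_const (1 : R_AbsRing) t))). }
    exact (continuous_plus _ _ _ (Hsq _ H1) (Hsq _ H2)). }
  split.
  - exact (continuous_mult _ _ _ H1 Hc).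
  - exact (continuous_mult _ _ _ (continuous_opp _ _ H2) Hc).
Qed.

Lemma continuous_uniform_approx (f : R -> R) (t : R) :
  (forall eps : posreal, exists g : R -> R, continuous g t /\
    locally t (fun s => Rabs (f s - g s) < eps)) ->
  continuous f t.
Proof.
  intros H; apply (filterlim_locally (U := R_UniformSpace) f (f t)); intros eps.
  assert (He : 0 < eps / 3) by (generalize (cond_pos eps); lra).
  destruct (H (mkposreal _ He)) as (g & Hg & Hfg).
  assert (Hg' := proj1 (filterlim_locally (U := R_UniformSpace) g (g t)) Hg (mkposreal _ He)).
  assert (Ht := locally_singleton _ _ Hfg).
  apply filter_imp with (2 := filter_and _ _ Hfg Hg').
  intros s [H1 H2].
  unfold ball in *; simpl in *; unfold AbsRing_ball, abs, minus, plus, opp in *; simpl in *.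
  replace (f s + - f t) with ((f s - g s) + ((g s + - g t) + - (f t - g t))) by ring.
  eapply Rle_lt_trans; [apply Rabs_triang|].
  assert (H3 := Rabs_triang (g s + - g t) (- (f t - g t))).
  rewrite Rabs_Ropp in H3; lra.
Qed.

Lemma C_continuous_uniform_approx (f : R -> C) (t : R) :
  (forall eps : posreal, exists g : R -> C, C_continuous g t /\
    locally t (fun s => Cmod (f s - g s) < eps)) ->
  C_continuous f t.
Proof.
  intros H; split; apply continuous_uniform_approx; intros eps;
    destruct (H eps) as (g & [H1 H2] & Hfg).
  - exists (fun s => Re (g s)); split; [assumption|].
    apply filter_imp with (2 := Hfg); intros s Hs.
    eapply Rle_lt_trans; [|exact Hs]; apply (re_le_Cmod (f s - g s)).
  - exists (fun s => Im (g s)); split; [assumption|].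
    apply filter_imp with (2 := Hfg); intros s Hs.
    eapply Rle_lt_trans; [|exact Hs]; apply (im_le_Cmod (f s - g s)).
Qed.

Lemma C_continuous_list_sum {T} (f : T -> R -> C) (L : list T) t :
  (forall i, C_continuous (f i) t) -> C_continuous (fun s => list_sum (fun i => f i s) L) t.
Proof.
  intros H; induction L as [|i L IH]; simpl.
  - apply C_continuous_const.
  - now apply C_continuous_plus.
Qed.

(** * The series of the logarithm *)

(** The terms of [Li_1(z) = - log (1 - z)], the polylogarithm that occurs for [k = 2]. *)
Definition li_term (z : C) (n : nat) : C := (z ^ S n * RtoC (/ INR (S n)))%C.

Definition li_partial (z : C) (N : nat) : C := list_sum (li_term z) (seq 0 N).

Lemma Cmod_li_term (z : C) n : Cmod (li_term z n) = Cmod z ^ S n * / INR (S n).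
Proof.
  unfold li_term; rewrite Cmod_mult, Cmod_pow, Cmod_R, Rabs_pos_eq; [reflexivity|].
  left; apply Rinv_0_lt_compat, INR_S_pos.
Qed.

Lemma pow_add_le (r : R) (m n : nat) : 0 <= r -> r <= 1 -> r ^ (m + n) <= r ^ m.
Proof.
  intros H0 H1; rewrite pow_add.
  assert (r ^ n <= 1) by (rewrite <- (pow1 n); now apply pow_incr).
  generalize (pow_le r m H0); nra.
Qed.

Lemma inv_INR_S_le_1 n : / INR (S n) <= 1.
Proof.
  rewrite <- Rinv_1; apply Rinv_le_contravar; [lra|].
  rewrite S_INR; generalize (pos_INR n); lra.
Qed.

Lemma li_term_le (z : C) n : Cmod (li_term z n) <= Cmod z ^ S n.
Proof.
  rewrite Cmod_li_term; generalize (pow_le _ (S n) (Cmod_ge_0 z)) (inv_INR_S_le_1 n); nra.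
Qed.

Lemma ex_li_series (z : C) : Cmod z < 1 ->
  exists l, is_series (K := C_AbsRing) (V := C_NormedModule) (li_term z) l.
Proof.
  intros Hz.
  apply (ex_series_le (K := C_AbsRing) (V := C_CompleteNormedModule) (li_term z)
    (fun n => Cmod z * Cmod z ^ n)).
  - intros n; apply li_term_le.
  - apply (ex_series_scal_l (Cmod z) (fun n => Cmod z ^ n)), ex_series_geom.
    rewrite Rabs_pos_eq; [assumption|apply Cmod_ge_0].
Qed.

(* Abel summation: [T N = S N + z^(N+1) / ((N+1)(1-z))] satisfies
   [T (N+1) - T N = z^(N+2) / (1-z) (1/(N+2) - 1/(N+1))], which telescopes in modulus. *)
Lemma li_partial_cauchy (z : C) N k : Cmod z <= 1 -> z <> 1 ->
  Cmod (li_partial z (N + k) - li_partial z N) <=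
  2 * Cmod z ^ S N / (INR (S N) * Cmod (1 - z)).
Proof.
  intros Hz Hz1.
  assert (Hne : (1 - z)%C <> 0).
  { intros E; apply Hz1; replace z with (1 - (1 - z))%C by ring; rewrite E; ring. }
  assert (Hd : 0 < Cmod (1 - z)) by now apply Cmod_gt_0.
  set (r := Cmod z) in *; assert (Hr : 0 <= r) by apply Cmod_ge_0.
  set (T := fun N => (li_partial z N + li_term z N / (1 - z))%C).
  assert (HT : forall n, T (S n) = (T n +
    z ^ S (S n) * RtoC (/ INR (S (S n)) - / INR (S n)) / (1 - z))%C).
  { intros n; unfold T, li_partial; rewrite list_sum_seq_S, RtoC_minus.
    unfold li_term; rewrite !(Cpow_S z); field; assumption. }
  assert (Hk : Cmod (T (N + k)%nat - T N) <=
    r ^ S N / Cmod (1 - z) * (/ INR (S N) - / INR (S (N + k)))).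
  { induction k as [|k IH].
    - rewrite Nat.add_0_r; replace (T N - T N)%C with (RtoC 0) by ring.
      rewrite Cmod_0; lra.
    - rewrite Nat.add_succ_r, HT.
      set (n := (N + k)%nat) in *.
      replace (T n + _ - T N)%C with ((T n - T N) +
        z ^ S (S n) * RtoC (/ INR (S (S n)) - / INR (S n)) / (1 - z))%C by ring.
      eapply Rle_trans; [apply Cmod_triangle|].
      assert (Hinv : / INR (S (S n)) <= / INR (S n)).
      { apply Rinv_le_contravar; [apply INR_S_pos|rewrite (S_INR (S n)); lra]. }
      assert (Hp : r ^ S (S n) <= r ^ S N).
      { replace (S (S n)) with (S N + S k)%nat by (unfold n; lia).
        now apply pow_add_le. }
      rewrite Cmod_div, Cmod_mult, Cmod_pow, Cmod_R, Rabs_left1 by (assumption || lra).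
      fold r.
      assert (r ^ S (S n) * - (/ INR (S (S n)) - / INR (S n)) / Cmod (1 - z) <=
        r ^ S N / Cmod (1 - z) * (/ INR (S n) - / INR (S (S n)))).
      { replace (r ^ S N / Cmod (1 - z) * (/ INR (S n) - / INR (S (S n))))
          with (r ^ S N * - (/ INR (S (S n)) - / INR (S n)) / Cmod (1 - z))
          by (unfold Rdiv; ring).
        apply Rmult_le_compat_r; [left; now apply Rinv_0_lt_compat|].
        apply Rmult_le_compat_r; lra. }
      lra. }
  replace (li_partial z (N + k) - li_partial z N)%C
    with ((T (N + k)%nat - T N) + (li_term z N / (1 - z) - li_term z (N + k) / (1 - z)))%C
    by (unfold T; ring).
  eapply Rle_trans; [apply Cmod_triangle|].
  assert (Ht := Cmod_triangle (li_term z N / (1 - z)) (- (li_term z (N + k) / (1 - z)))).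
  rewrite Cmod_opp, !Cmod_div, !Cmod_li_term in Ht by assumption.
  fold r in Ht.
  assert (Hp : r ^ S (N + k) <= r ^ S N).
  { replace (S (N + k)) with (S N + k)%nat by lia.
    now apply pow_add_le. }
  assert (Hi : 0 < / INR (S (N + k))) by apply Rinv_0_lt_compat, INR_S_pos.
  assert (Hp2 : r ^ S (N + k) * / INR (S (N + k)) / Cmod (1 - z) <=
    r ^ S N * / INR (S (N + k)) / Cmod (1 - z)).
  { apply Rmult_le_compat_r; [left; now apply Rinv_0_lt_compat|].
    apply Rmult_le_compat_r; lra. }
  assert (Hn := INR_S_pos N).
  replace (2 * r ^ S N / (INR (S N) * Cmod (1 - z)))
    with (r ^ S N / Cmod (1 - z) * (/ INR (S N) - / INR (S (N + k))) +
      (r ^ S N * / INR (S N) / Cmod (1 - z) + r ^ S N * / INR (S (N + k)) / Cmod (1 - z)))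
    by (field; repeat split; try lra; apply Rgt_not_eq, INR_S_pos).
  unfold Cminus in *; lra.
Qed.

(** The bound involves [1/|1 - z|] and not the [1/(1 - |z|)] of a geometric tail. The latter would
    blow up as [t] tends to 0, where [|z|] tends to 1. *)
Lemma li_tail (z l : C) N : Cmod z <= 1 -> z <> 1 ->
  is_series (K := C_AbsRing) (V := C_NormedModule) (li_term z) l ->
  Cmod (l - li_partial z N) <= 2 * Cmod z ^ S N / (INR (S N) * Cmod (1 - z)).
Proof.
  intros Hz Hz1 Hl; apply Rle_plus_epsilon; intros eps Heps.
  destruct (proj1 (is_series_C_iff _ _) Hl (mkposreal eps Heps)) as [N0 HN].
  specialize (HN (N + N0)%nat ltac:(lia)); simpl pos in HN.
  fold (li_partial z (N + N0)) in HN.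
  assert (H := li_partial_cauchy z N N0 Hz Hz1).
  replace (l - li_partial z N)%C
    with (- (li_partial z (N + N0) - l) + (li_partial z (N + N0) - li_partial z N))%C
    by ring.
  eapply Rle_trans; [apply Cmod_triangle|]; rewrite Cmod_opp; lra.
Qed.

Lemma polylog_1_series (z : C) : Cmod z < 1 ->
  is_series (K := C_AbsRing) (V := C_NormedModule) (li_term z) (polylog (INR 2 - 1)%R z).
Proof.
  intros Hz; destruct (ex_li_series z Hz) as [l Hl].
  replace (polylog (INR 2 - 1)%R z) with l; [exact Hl|].
  symmetry; apply CSeries_unique.
  eapply is_series_ext; [|exact Hl].
  intros n; unfold li_term, Rcpow.
  replace (INR 2 - 1) with 1 by (simpl; ring).
  rewrite Cmult_1_l, Cexp_RtoC, exp_ln by apply INR_S_pos.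
  rewrite RtoC_inv; [reflexivity|apply Rgt_not_eq, INR_S_pos].
Qed.

(** * The integral as an unordered sum *)

Lemma exp_pow (a : R) n : exp a ^ n = exp (INR n * a).
Proof.
  induction n as [|n IH].
  - simpl; now rewrite Rmult_0_l, exp_0.
  - rewrite S_INR, Rmult_plus_distr_r, exp_plus, <- IH, Rmult_1_l; simpl; ring.
Qed.

Lemma geometric_list_sum (y : C) N :
  ((1 - y) * list_sum (fun q => y ^ q) (seq 0 N) = 1 - y ^ N)%C.
Proof.
  induction N as [|N IH]; [simpl; ring|].
  rewrite list_sum_seq_S, Cmult_plus_distr_l, IH, Cpow_S; ring.
Qed.

Lemma Cmod_li_partial_le (z : C) P : Cmod z <= 1 -> Cmod (li_partial z P) <= INR P * Cmod z.
Proof.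
  intros Hz; assert (H0 := Cmod_ge_0 z); induction P as [|P IH].
  - unfold li_partial; simpl; rewrite Cmod_0; lra.
  - unfold li_partial in *; rewrite list_sum_seq_S, S_INR.
    eapply Rle_trans; [apply Cmod_triangle|].
    assert (H := li_term_le z P).
    assert (H1 : Cmod z ^ S P <= Cmod z ^ 1) by exact (pow_add_le (Cmod z) 1 P H0 Hz).
    rewrite pow_1 in H1; lra.
Qed.

Definition box (P N : nat) : list (nat * nat) := list_prod (seq 0 P) (seq 0 N).

(** The decay rate [p x + q] of the exponential attached to [(p, q)]; its integral over the
    half-line contributes [1/(p x + q)]. *)
Definition hzn_freq (x : R) (i : nat * nat) : R := INR (S (fst i)) * x + INR (snd i).

Definition hzn_term (x : R) (i : nat * nat) : C :=
  RtoC (/ (INR (S (fst i)) * hzn_freq x i)).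

Definition hzn_var (x alpha t : R) : C := (RtoC (exp (- (x * t))) * e2pi alpha)%C.

Definition hzn_kernel (x alpha beta t : R) : C :=
  (polylog (INR 2 - 1)%R (Cexp (- (x * t)) * e2pi alpha)
     / (1 - Cexp (- t)%R * e2pi beta))%C.

Lemma hzn_freq_pos x i : 0 < x -> 0 < hzn_freq x i.
Proof.
  intros Hx; unfold hzn_freq.
  generalize (INR_S_pos (fst i)) (pos_INR (snd i)); intros.
  assert (0 < INR (S (fst i)) * x) by now apply Rmult_lt_0_compat. lra.
Qed.

Lemma hzn_kernel_alt x alpha beta t :
  hzn_kernel x alpha beta t =
  (polylog (INR 2 - 1)%R (hzn_var x alpha t) / (1 - RtoC (exp (- t)) * e2pi beta))%C.
Proof.
  unfold hzn_kernel, hzn_var.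
  now rewrite <- RtoC_mult, <- RtoC_opp, !Cexp_RtoC.
Qed.

Lemma exp_neg_between y : 0 < y -> 0 < exp (- y) < 1.
Proof.
  intros Hy; split; [apply exp_pos|].
  rewrite <- exp_0; apply exp_increasing; lra.
Qed.

Lemma Cmod_hzn_var x alpha t : Cmod (hzn_var x alpha t) = exp (- (x * t)).
Proof.
  unfold hzn_var; rewrite Cmod_mult, Cmod_e2pi, Cmod_R, Rmult_1_r.
  apply Rabs_pos_eq; left; apply exp_pos.
Qed.

(** Since [e^(-(p x + q) t)] factors, the sum over a rectangle is a partial sum of the logarithm
    times a partial geometric sum, mirroring numerator and denominator of the kernel. *)
Lemma box_exp_sum x alpha beta t P N :
  list_sum (fun i => lattice_char alpha beta i * RtoC (/ INR (S (fst i)))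
      * RtoC (exp (- (hzn_freq x i * t))))%C (box P N) =
  (li_partial (hzn_var x alpha t) P *
   list_sum (fun q => (RtoC (exp (- t)) * e2pi beta) ^ q) (seq 0 N))%C.
Proof.
  unfold box; rewrite list_sum_list_prod.
  set (S0 := list_sum _ (seq 0 N)).
  transitivity (list_sum (fun m => S0 * li_term (hzn_var x alpha t) m)%C (seq 0 P)).
  2:{ rewrite list_sum_scal; unfold li_partial; ring. }
  apply list_sum_ext; intros m; rewrite Cmult_comm; unfold S0.
  rewrite <- list_sum_scal; apply list_sum_ext; intros q.
  simpl fst; rewrite lattice_char_alt; unfold li_term, hzn_var.
  rewrite !Cpow_mult_l, <- !RtoC_pow, !exp_pow; unfold hzn_freq; simpl fst; simpl snd.
  replace (- ((INR (S m) * x + INR q) * t))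
    with (INR (S m) * - (x * t) + INR q * - t) by ring.
  rewrite exp_plus, RtoC_mult; ring.
Qed.

Section kernel.
Variables (x alpha beta : R).
Hypotheses (Hx : 0 < x) (Halpha : non_integer alpha) (Hbeta : non_integer beta).

Lemma hzn_denominator_bounds : exists mu, 0 < mu /\ forall t, 0 < t ->
  mu <= Cmod (1 - hzn_var x alpha t) /\ mu <= Cmod (1 - RtoC (exp (- t)) * e2pi beta).
Proof.
  destruct (one_sub_e2pi_lower_bound alpha Halpha) as (mu1 & Hmu1 & H1).
  destruct (one_sub_e2pi_lower_bound beta Hbeta) as (mu2 & Hmu2 & H2).
  exists (Rmin mu1 mu2); split; [now apply Rmin_pos|]; intros t Ht.
  assert (E1 := exp_neg_between (x * t) ltac:(now apply Rmult_lt_0_compat)).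
  assert (E2 := exp_neg_between t Ht).
  split.
  - eapply Rle_trans; [apply Rmin_l|apply H1; lra].
  - eapply Rle_trans; [apply Rmin_r|apply H2; lra].
Qed.

(** Keeping the exponential makes the bound integrable over the half-line, with integral
    [2/((P+1)^2 mu x)]. *)
Lemma hzn_li_tail mu t P : 0 < t -> 0 < mu -> mu <= Cmod (1 - hzn_var x alpha t) ->
  Cmod (polylog (INR 2 - 1)%R (hzn_var x alpha t) - li_partial (hzn_var x alpha t) P) <=
  2 / (INR (S P) * mu) * exp (- (INR (S P) * x * t)).
Proof.
  intros Ht Hmu Hz.
  assert (E1 := exp_neg_between (x * t) ltac:(now apply Rmult_lt_0_compat)).
  assert (Hm := Cmod_hzn_var x alpha t).
  assert (Hne : hzn_var x alpha t <> 1).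
  { intros E; rewrite E in Hz; replace (1 - 1)%C with (RtoC 0) in Hz by ring.
    rewrite Cmod_0 in Hz; lra. }
  assert (HP := INR_S_pos P).
  eapply Rle_trans; [apply li_tail; [lra|exact Hne|apply polylog_1_series; lra]|].
  rewrite Hm, exp_pow.
  replace (INR (S P) * - (x * t)) with (- (INR (S P) * x * t)) by ring.
  assert (H0 := exp_pos (- (INR (S P) * x * t))).
  unfold Rdiv; rewrite Rmult_assoc, (Rmult_comm (exp _)), <- Rmult_assoc.
  apply Rmult_le_compat_r; [lra|]. apply Rmult_le_compat_l; [lra|].
  apply Rinv_le_contravar; [now apply Rmult_lt_0_compat|].
  apply Rmult_le_compat_l; lra.
Qed.

(** The values of [polylog] are only known as limits of series, so continuity is inherited from the
    partial sums, which converge uniformly on [t > 0]. *)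
Lemma C_continuous_polylog_hzn_var t : 0 < t ->
  C_continuous (fun t => polylog (INR 2 - 1)%R (hzn_var x alpha t)) t.
Proof.
  intros Ht; destruct hzn_denominator_bounds as (mu & Hmu & Hden).
  apply C_continuous_uniform_approx; intros eps.
  destruct (archimed_cor1 (eps * mu / 2)) as (P & HP & HP0).
  { generalize (cond_pos eps); intros; apply Rdiv_lt_0_compat; [|lra].
    now apply Rmult_lt_0_compat. }
  exists (fun t => li_partial (hzn_var x alpha t) P); split.
  - unfold li_partial; apply (C_continuous_list_sum (fun n s => li_term (hzn_var x alpha s) n)).
    intros n; unfold li_term, hzn_var.
    apply (C_continuous_mult (fun s => (RtoC (exp (- (x * s))) * e2pi alpha) ^ S n)%C);
      [|apply C_continuous_const].
    apply C_continuous_pow, C_continuous_mult;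
      [apply C_continuous_exp_decay|apply C_continuous_const].
  - apply filter_imp with (2 := open_gt 0 t Ht); intros s Hs.
    destruct (Hden s Hs) as [H1 _].
    eapply Rle_lt_trans; [now apply hzn_li_tail with (mu := mu)|].
    assert (HP1 := INR_S_pos P).
    assert (E := exp_neg_between (INR (S P) * x * s)
      ltac:(repeat apply Rmult_lt_0_compat; assumption)).
    assert (HPP : 0 < INR P) by now apply lt_0_INR.
    assert (Hi : / INR (S P) < eps * mu / 2).
    { apply Rle_lt_trans with (2 := HP), Rinv_le_contravar; [assumption|].
      rewrite S_INR; lra. }
    assert (Hq : 2 / (INR (S P) * mu) < eps).
    { replace (2 / (INR (S P) * mu)) with (/ INR (S P) * (2 / mu)) by (field; lra).
      apply Rmult_lt_compat_r with (r := 2 / mu) in Hi; [|apply Rdiv_lt_0_compat; lra].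
      replace (eps * mu / 2 * (2 / mu)) with (pos eps) in Hi by (field; lra); exact Hi. }
    assert (0 < 2 / (INR (S P) * mu)).
    { apply Rdiv_lt_0_compat; [lra|now apply Rmult_lt_0_compat]. }
    nra.
Qed.

Lemma ex_RInt_hzn_kernel a b : 0 < a < b ->
  ex_RInt (V := C_R_NormedModule) (hzn_kernel x alpha beta) a b.
Proof.
  intros Hab; destruct hzn_denominator_bounds as (mu & Hmu & Hden).
  apply (ex_RInt_ext (V := C_R_NormedModule) (fun t => polylog (INR 2 - 1)%R (hzn_var x alpha t)
    * / (1 - RtoC (exp (- t)) * e2pi beta))%C).
  { intros t _; now rewrite hzn_kernel_alt. }
  apply ex_RInt_C_continuous; intros t Ht.
  rewrite Rmin_left, Rmax_right in Ht by lra.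
  apply C_continuous_mult; [apply C_continuous_polylog_hzn_var; lra|].
  apply C_continuous_inv.
  - destruct (Hden t ltac:(lra)) as [_ H]; apply Cmod_gt_0; lra.
  - apply C_continuous_plus; [apply C_continuous_const|].
    assert (Hc : C_continuous (fun s => (- e2pi beta) * RtoC (exp (- (1 * s))))%C t).
    { apply C_continuous_mult; [apply C_continuous_const|apply C_continuous_exp_decay]. }
    destruct Hc as [Hc1 Hc2]; split.
    + eapply continuous_ext; [|exact Hc1]; intros s; simpl; rewrite Rmult_1_l; f_equal; ring.
    + eapply continuous_ext; [|exact Hc2]; intros s; simpl; rewrite Rmult_1_l; f_equal; ring.
Qed.

(** With [y = e^(-t) e(beta)], the two errors are the logarithm tail over [1 - y] and the partial
    logarithm times the geometric tail [y^N/(1 - y)]. The crude bound [P e^(-x t)] on the partial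
    logarithm suffices, since integration leaves [P/(x + N)] and [N] can be taken large after
    [P]. *)
Lemma hzn_kernel_approx mu t P N : 0 < t -> 0 < mu ->
  mu <= Cmod (1 - hzn_var x alpha t) -> mu <= Cmod (1 - RtoC (exp (- t)) * e2pi beta) ->
  Cmod (hzn_kernel x alpha beta t -
    list_sum (fun i => lattice_char alpha beta i * RtoC (/ INR (S (fst i)))
      * RtoC (exp (- (hzn_freq x i * t))))%C (box P N)) <=
  2 / (INR (S P) * mu ^ 2) * exp (- (INR (S P) * x * t)) +
  INR P / mu * exp (- ((x + INR N) * t)).
Proof.
  intros Ht Hmu H1 H2.
  rewrite hzn_kernel_alt, box_exp_sum.
  set (z := hzn_var x alpha t) in *; set (y := (RtoC (exp (- t)) * e2pi beta)%C) in *.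
  set (Li := polylog (INR 2 - 1)%R z).
  assert (Hy : (1 - y)%C <> 0) by (apply Cmod_gt_0; lra).
  replace (Li / (1 - y) - li_partial z P * list_sum (fun q => y ^ q) (seq 0 N))%C
    with ((Li - li_partial z P) / (1 - y) + li_partial z P * y ^ N / (1 - y))%C.
  2:{ replace (list_sum (fun q => y ^ q)%C (seq 0 N)) with ((1 - y ^ N) / (1 - y))%C.
      - field; assumption.
      - rewrite <- geometric_list_sum; field; assumption. }
  assert (Hinv : / Cmod (1 - y) <= / mu) by now apply Rinv_le_contravar.
  assert (Hinv0 : 0 < / Cmod (1 - y)) by (apply Rinv_0_lt_compat; lra).
  assert (E1 := exp_neg_between (x * t) ltac:(now apply Rmult_lt_0_compat)).
  assert (HP := INR_S_pos P).
  eapply Rle_trans; [apply Cmod_triangle|]; apply Rplus_le_compat.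
  - rewrite Cmod_div by assumption.
    replace (2 / (INR (S P) * mu ^ 2) * exp (- (INR (S P) * x * t)))
      with (2 / (INR (S P) * mu) * exp (- (INR (S P) * x * t)) * / mu) by (field; lra).
    apply Rmult_le_compat; [apply Cmod_ge_0|lra| |assumption].
    now apply hzn_li_tail.
  - rewrite Cmod_div, Cmod_mult, Cmod_pow by assumption.
    assert (Ey : Cmod y = exp (- t)).
    { unfold y; rewrite Cmod_mult, Cmod_e2pi, Cmod_R, Rmult_1_r.
      apply Rabs_pos_eq; left; apply exp_pos. }
    assert (Hz : Cmod z = exp (- (x * t))) by apply Cmod_hzn_var.
    rewrite Ey, exp_pow.
    assert (Hl := Cmod_li_partial_le z P ltac:(lra)); rewrite Hz in Hl.
    replace (INR P / mu * exp (- ((x + INR N) * t)))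
      with (INR P * exp (- (x * t)) * exp (INR N * - t) * / mu).
    + apply Rmult_le_compat; [|lra| |assumption].
      * apply Rmult_le_pos; [apply Cmod_ge_0|left; apply exp_pos].
      * apply Rmult_le_compat_r; [left; apply exp_pos|assumption].
    + rewrite (Rmult_assoc (INR P)), <- exp_plus.
      replace (- (x * t) + INR N * - t) with (- ((x + INR N) * t)) by ring.
      unfold Rdiv; ring.
Qed.

(** Summation by parts in a finite row; truncation at [N] leaves the boundary term with one extra
    factor [e2pi beta]. *)
Lemma diff_snd_row_sum (f : nat * nat -> C) m N :
  list_sum (fun q => lattice_char alpha beta (m, q) * diff_snd f (m, q))%C (seq 0 (S N)) =
  ((1 - e2pi beta) * list_sum (fun q => lattice_char alpha beta (m, q) * f (m, q)) (seq 0 (S N))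
   + e2pi beta * (lattice_char alpha beta (m, N) * f (m, N)))%C.
Proof.
  induction N as [|N IH].
  - unfold diff_snd; simpl; ring.
  - rewrite list_sum_seq_S, IH, (list_sum_seq_S _ (S N)).
    unfold diff_snd; simpl snd; simpl fst; cbv iota.
    rewrite !lattice_char_alt, (Cpow_S (e2pi beta)); ring.
Qed.

(** The untransformed series is not absolutely convergent, so [U / (1 - e2pi beta)] is approached
    along boxes only. The boundary terms at [q = N] add up to at most [P/(x + N)], each being at
    most [1/(x + N)]. *)
Lemma box_sum_close (U : C) (eps : posreal) :
  is_unordered_sum (fun i => lattice_char alpha beta i * diff_snd (hzn_term x) i)%C U ->
  exists M, forall P N, (M <= P)%nat -> (M <= N)%nat ->
    Cmod (list_sum (fun i => lattice_char alpha beta i * hzn_term x i)%C (box P (S N))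
      - U / (1 - e2pi beta)) <=
    (eps + INR P / (x + INR N)) / Cmod (1 - e2pi beta).
Proof.
  intros HU; destruct (HU eps) as [L0 H0].
  destruct (incl_seq_max (map fst L0)) as [M1 HM1].
  destruct (incl_seq_max (map snd L0)) as [M2 HM2].
  exists (max M1 M2); intros P N HP HN.
  assert (HB := e2pi_neq_1 beta Hbeta).
  assert (HB0 : 0 < Cmod (1 - e2pi beta)) by now apply Cmod_gt_0.
  specialize (H0 (box P (S N)) (NoDup_list_prod _ _ (seq_NoDup _ _) (seq_NoDup _ _))
    (incl_list_prod _ _ _ (HM1 P ltac:(lia)) (HM2 (S N) ltac:(lia)))).
  set (V := list_sum (fun i => lattice_char alpha beta i * hzn_term x i)%C (box P (S N))).
  set (W := list_sum (fun m => lattice_char alpha beta (m, N) * hzn_term x (m, N))%C (seq 0 P)).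
  assert (E : list_sum (fun i => lattice_char alpha beta i * diff_snd (hzn_term x) i)%C
    (box P (S N)) = ((1 - e2pi beta) * V + e2pi beta * W)%C).
  { unfold V, W, box; rewrite !list_sum_list_prod, <- !list_sum_scal, <- list_sum_plus.
    apply list_sum_ext; intros m; apply diff_snd_row_sum. }
  rewrite E in H0.
  assert (HW : Cmod W <= INR P / (x + INR N)).
  { assert (HxN : 0 < x + INR N) by (generalize (pos_INR N); lra).
    unfold W; eapply Rle_trans; [apply Cmod_list_sum|].
    apply Rle_trans with (rsum (fun _ => / (x + INR N)) (seq 0 P)).
    - apply rsum_le; intros m.
      rewrite Cmod_mult, Cmod_lattice_char, Rmult_1_l; unfold hzn_term, hzn_freq.
      simpl fst; simpl snd.
      assert (Hm : 1 <= INR (S m)) by (rewrite S_INR; generalize (pos_INR m); lra).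
      assert (Hf : x + INR N <= INR (S m) * x + INR N) by nra.
      rewrite Cmod_R, Rabs_pos_eq.
      + apply Rinv_le_contravar; [assumption|]. nra.
      + left; apply Rinv_0_lt_compat, Rmult_lt_0_compat; lra.
    - clear; right; induction P as [|P IH]; [simpl; unfold Rdiv; ring|].
      rewrite rsum_seq_S, IH, S_INR; unfold Rdiv; ring. }
  replace (V - U / (1 - e2pi beta))%C
    with ((((1 - e2pi beta) * V + e2pi beta * W - U) - e2pi beta * W) / (1 - e2pi beta))%C
    by (field; assumption).
  rewrite Cmod_div by assumption.
  apply Rmult_le_compat_r; [left; now apply Rinv_0_lt_compat|].
  eapply Rle_trans; [apply Cmod_triangle|].
  rewrite Cmod_opp, Cmod_mult, Cmod_e2pi; lra.
Qed.

Lemma ex_large_INR (y : R) : 0 < y -> exists M, forall N, (M <= N)%nat -> 1 <= y * INR N.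
Proof.
  intros Hy; destruct (INR_unbounded (/ y)) as [M HM]; exists M; intros N HN.
  apply Rle_trans with (y * INR M).
  - apply Rmult_gt_compat_l with (r := y) in HM; [|lra].
    rewrite Rinv_r in HM; lra.
  - apply Rmult_le_compat_l; [lra|now apply le_INR].
Qed.

Lemma is_RInt_gen_hzn_kernel (U : C) :
  is_unordered_sum (fun i => lattice_char alpha beta i * diff_snd (hzn_term x) i)%C U ->
  is_RInt_gen (V := C_R_NormedModule) (hzn_kernel x alpha beta)
    (at_right 0) (Rbar_locally p_infty) (U / (1 - e2pi beta))%C.
Proof.
  intros HU; apply is_RInt_gen_approx; [exact ex_RInt_hzn_kernel|]; intros eps.
  destruct hzn_denominator_bounds as (mu & Hmu & Hden).
  set (B := Cmod (1 - e2pi beta)).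
  assert (HB : 0 < B) by now apply Cmod_gt_0, e2pi_neq_1.
  assert (Heps := cond_pos eps).
  assert (He1 : 0 < eps * B / 2) by (apply Rdiv_lt_0_compat; [now apply Rmult_lt_0_compat|lra]).
  destruct (box_sum_close U (mkposreal _ He1) HU) as [M HM]; simpl pos in HM.
  (* This threshold on [P] brings the integral of the logarithm error, at most [2/((P+1)^2 mu^2 x)],
     down to [eps/3]. *)
  assert (Hpos1 : 0 < eps * mu ^ 2 * x / 6).
  { apply Rdiv_lt_0_compat; [|lra]. repeat apply Rmult_lt_0_compat; assumption || lra. }
  destruct (ex_large_INR _ Hpos1) as [M1 HM1].
  set (P := S (max M M1)).
  assert (HP1 := HM1 (S P) ltac:(unfold P; lia)).
  assert (HP0 : 0 < INR P) by apply INR_S_pos.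
  (* [N] is chosen after [P]. This condition gives [P/(x + N) < eps B/2] for the boundary term; the
     next one brings the integral of the geometric error, at most [P/(mu (x + N + 1))], below
     [2 eps/3]. *)
  assert (Hpos2 : 0 < eps * B / (3 * INR P)).
  { apply Rdiv_lt_0_compat; [now apply Rmult_lt_0_compat|lra]. }
  assert (Hpos3 : 0 < eps * mu / (3 * INR P)).
  { apply Rdiv_lt_0_compat; [now apply Rmult_lt_0_compat|lra]. }
  destruct (ex_large_INR _ Hpos2) as [M2 HM2].
  destruct (ex_large_INR _ Hpos3) as [M3 HM3].
  set (N := S (max M (max M2 M3))).
  assert (HN2 := HM2 N ltac:(unfold N; lia)).
  assert (HN3 := HM3 (S N) ltac:(unfold N; lia)).
  specialize (HM P N ltac:(unfold P; lia) ltac:(unfold N; lia)).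
  assert (HN0 : 0 < INR N) by apply INR_S_pos.
  assert (HSN := INR_S_pos N); assert (HSP := INR_S_pos P).
  exists (fun t => list_sum (fun i => lattice_char alpha beta i * RtoC (/ INR (S (fst i)))
      * RtoC (exp (- (hzn_freq x i * t))))%C (box P (S N))),
    (list_sum (fun i => lattice_char alpha beta i * hzn_term x i)%C (box P (S N))),
    (fun t => 2 / (INR (S P) * mu ^ 2) * exp (- (INR (S P) * x * t)) +
      INR P / mu * exp (- ((x + INR (S N)) * t))).
  repeat split.
  - erewrite list_sum_ext; [apply (is_RInt_gen_list_sum_exp_decay
      (fun i => lattice_char alpha beta i * RtoC (/ INR (S (fst i))))%C (hzn_freq x))|].
    + intros i; now apply hzn_freq_pos.
    + intros i; unfold hzn_term; rewrite Rinv_mult, RtoC_mult; ring.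
  - eapply Rle_lt_trans; [exact HM|]; fold B.
    apply Rmult_lt_reg_r with B; [assumption|].
    replace ((eps * B / 2 + INR P / (x + INR N)) / B * B)
      with (eps * B / 2 + INR P / (x + INR N)) by (field; split; lra).
    assert (INR P / (x + INR N) < eps * B / 2); [|lra].
    apply Rmult_lt_reg_r with (x + INR N); [lra|].
    replace (INR P / (x + INR N) * (x + INR N)) with (INR P) by (field; lra).
    apply Rmult_le_compat_r with (r := INR P) in HN2; [|lra].
    replace (eps * B / (3 * INR P) * INR N * INR P) with (eps * B / 3 * INR N) in HN2
      by (field; lra).
    assert (0 < eps * B) by now apply Rmult_lt_0_compat.
    assert (0 < eps * B * INR N) by now apply Rmult_lt_0_compat.
    assert (0 < eps * B * x) by now apply Rmult_lt_0_compat.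
    lra.
  - intros t Ht; destruct (Hden t Ht) as [H1 H2]; now apply hzn_kernel_approx.
  - intros a b Hab.
    set (l1 := INR (S P) * x); set (l2 := x + INR (S N)).
    assert (Hl1 : 0 < l1) by now apply Rmult_lt_0_compat.
    assert (Hl2 : 0 < l2) by (unfold l2; lra).
    assert (Hexp : forall l, 0 < l -> (exp (- (l * a)) - exp (- (l * b))) / l <= / l).
    { intros l Hl; assert (0 < l * a) by (apply Rmult_lt_0_compat; lra).
      assert (H1 := exp_neg_between (l * a) H); assert (H2 := exp_pos (- (l * b))).
      rewrite <- (Rmult_1_l (/ l)); apply Rmult_le_compat_r;
        [left; now apply Rinv_0_lt_compat|lra]. }
    eexists; split.
    + apply (is_RInt_plus (V := R_NormedModule));
        apply (is_RInt_scal (V := R_NormedModule)), is_RInt_exp_decay; lra.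
    + set (c1 := 2 / (INR (S P) * mu ^ 2)); set (c2 := INR P / mu).
      change (c1 * ((exp (- (l1 * a)) - exp (- (l1 * b))) / l1) +
        c2 * ((exp (- (l2 * a)) - exp (- (l2 * b))) / l2) < eps).
      assert (Hmu2 : 0 < mu ^ 2) by now apply pow_lt.
      assert (Hc1 : 0 < c1) by (apply Rdiv_lt_0_compat; [lra|now apply Rmult_lt_0_compat]).
      assert (Hc2 : 0 < c2) by now apply Rdiv_lt_0_compat.
      assert (Q1 : c1 * ((exp (- (l1 * a)) - exp (- (l1 * b))) / l1) <= c1 * / l1)
        by (apply Rmult_le_compat_l; [lra|auto]).
      assert (Q2 : c2 * ((exp (- (l2 * a)) - exp (- (l2 * b))) / l2) <= c2 * / l2)
        by (apply Rmult_le_compat_l; [lra|auto]).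
      assert (Q3 : c1 * / l1 <= eps / 3).
      { apply Rmult_le_reg_r with (l1 * (INR (S P) * mu ^ 2));
          [repeat apply Rmult_lt_0_compat; assumption || lra|].
        replace (c1 * / l1 * (l1 * (INR (S P) * mu ^ 2))) with 2
          by (unfold c1; field; repeat split; lra).
        assert (1 <= INR (S P)) by (rewrite (S_INR P); lra).
        assert (Hx2 : eps / 3 * (l1 * (INR (S P) * mu ^ 2)) =
          2 * (eps * mu ^ 2 * x / 6 * INR (S P)) * INR (S P))
          by (unfold l1; field).
        rewrite Hx2; nra. }
      assert (Q4 : c2 * / l2 < eps / 3 * 2).
      { apply Rmult_lt_reg_r with (l2 * mu); [now apply Rmult_lt_0_compat|].
        replace (c2 * / l2 * (l2 * mu)) with (INR P) by (unfold c2; field; lra).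
        apply Rmult_le_compat_r with (r := INR P) in HN3; [|lra].
        replace (eps * mu / (3 * INR P) * INR (S N) * INR P)
          with (eps * mu / 3 * INR (S N)) in HN3 by (field; lra).
        assert (0 < eps * mu) by now apply Rmult_lt_0_compat.
        assert (0 < eps * mu * INR (S N)) by now apply Rmult_lt_0_compat.
        assert (0 < eps * mu * x) by now apply Rmult_lt_0_compat.
        unfold l2; lra. }
      lra.
Qed.

Lemma HZN_2_value (U : C) :
  is_unordered_sum (fun i => lattice_char alpha beta i * diff_snd (hzn_term x) i)%C U ->
  HZN 2 x alpha beta = (U / (1 - e2pi beta))%C.
Proof.
  intros HU; unfold HZN.
  apply (is_RInt_gen_unique (V := C_R_CompleteNormedModule)).
  now apply is_RInt_gen_hzn_kernel.
Qed.

(** For [q >= 1] the difference of two consecutive terms has order [1/(p n^2)], where [n = p + q].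
    As [n >= p] and [n >= q + 1], [p n^2] is at least [(p (q+1))^(3/2)], hence the choice
    [eps = 1/2]. On the axis the order is [1/p^2]. *)
Lemma hzn_ex_sum :
  exists U, is_unordered_sum (fun i => lattice_char alpha beta i * diff_snd (hzn_term x) i)%C U.
Proof.
  (* Chosen so that [k (p + y + 1) <= p x + y] for [p >= 1]: one half of [p x] covers [k p], the
     other half covers the extra [k]. *)
  set (k := Rmin (x / 2) (1 / 2)).
  assert (Hk : 0 < k) by (apply Rmin_pos; lra).
  assert (Hk1 : k <= x / 2) by apply Rmin_l; assert (Hk2 : k <= 1 / 2) by apply Rmin_r.
  assert (Hk4 : 1 < / k ^ 2).
  { rewrite <- Rinv_1; apply Rinv_lt_contravar; [rewrite Rmult_1_r; now apply pow_lt|nra]. }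
  apply zeta2_dominated_sum with (1 / 2) (/ k ^ 2); [lra|lra|].
  intros [m q]; rewrite Cmod_mult, Cmod_lattice_char, Rmult_1_l.
  assert (Hp : 1 <= INR (S m)) by (rewrite S_INR; generalize (pos_INR m); lra).
  set (p := INR (S m)) in *; set (n := lattice_norm m q).
  assert (Hn : 0 < n) by (generalize (lattice_norm_ge_1 m q); unfold n; lra).
  destruct q as [|q].
  { assert (En : n = p) by (unfold n, lattice_norm; simpl INR; fold p; unfold p; simpl INR; ring).
    unfold diff_snd, hzn_term, hzn_freq; simpl fst; simpl snd; fold p; cbv iota.
    rewrite Cmod_R, Rabs_pos_eq by (left; apply Rinv_0_lt_compat, Rmult_lt_0_compat; simpl (INR 0); nra).
    apply Rle_trans with (/ k ^ 2 * exp (- (1 + 2 * (1 / 2)) * ln n)).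
    - rewrite En; replace (- (1 + 2 * (1 / 2)) * ln p) with (INR 2 * - ln p) by (simpl; field).
      rewrite <- exp_pow, exp_Ropp, exp_ln by lra.
      replace (/ k ^ 2 * (/ p) ^ 2) with (/ (p * (p * k ^ 2))) by (field; lra).
      simpl (INR 0); rewrite Rplus_0_r.
      apply Rinv_le_contravar; [repeat apply Rmult_lt_0_compat; lra|].
      apply Rmult_le_compat_l; [lra|]. apply Rmult_le_compat_l; [lra|]. nra.
    - apply Rmult_le_compat_l; [lra|]. apply axis_le_zeta2; lra. }
  assert (Hterm : Cmod (diff_snd (hzn_term x) (m, S q)) <= / (p * (k * n) ^ 2)).
  { unfold diff_snd, hzn_term, hzn_freq; simpl fst; simpl snd; fold p; cbv iota.
    rewrite <- RtoC_minus, Cmod_R, S_INR.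
    assert (En : n = p + INR q + 1)
      by (unfold n, lattice_norm; rewrite (S_INR q); fold p; ring).
    assert (Hq := pos_INR q); set (y := INR q) in *.
    assert (Hu : k * n <= p * x + y).
    { assert (k * p <= x / 2 * p) by (apply Rmult_le_compat_r; lra).
      assert (k * y <= 1 / 2 * y) by (apply Rmult_le_compat_r; lra).
      assert (k * 1 <= k * p) by (apply Rmult_le_compat_l; lra).
      rewrite En; lra. }
    assert (Hkn : 0 < k * n) by now apply Rmult_lt_0_compat.
    replace (/ (p * (p * x + (y + 1))) - / (p * (p * x + y)))
      with (- / (p * ((p * x + (y + 1)) * (p * x + y)))) by (field; repeat split; nra).
    rewrite Rabs_Ropp, Rabs_pos_eq.
    + apply Rinv_le_contravar; [apply Rmult_lt_0_compat; nra|].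
      apply Rmult_le_compat_l; [lra|]; nra.
    + left; apply Rinv_0_lt_compat, Rmult_lt_0_compat; [lra|nra]. }
  eapply Rle_trans; [exact Hterm|].
  replace (/ (p * (k * n) ^ 2)) with (/ k ^ 2 * (/ p * (/ n) ^ 2)) by (field; repeat split; lra).
  apply Rmult_le_compat_l; [lra|].
  destruct (ln_lattice_norm m (S q)) as [H1 H2]; fold p n in H1; fold n in H2.
  rewrite <- (exp_ln p), <- (exp_ln n) by lra.
  rewrite <- !exp_Ropp, exp_pow, <- exp_plus; unfold zeta2_term, zeta_term; simpl fst; simpl snd.
  rewrite <- exp_plus; apply exp_le_compat; fold p.
  replace (INR 2) with 2 by reflexivity; lra.
Qed.

End kernel.

(** * Convergence of the series of the form, partial fractions, and the conclusion *)

Lemma bqf_ex_diff_sum Q alpha beta s :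
  0 < qa Q -> 0 < qb Q -> 0 < qc Q -> 1 / 2 < Re s ->
  exists l, is_unordered_sum (fun i => lattice_char alpha beta i * diff_snd (bqf_term Q s) i)%C l.
Proof.
  intros Ha Hb Hc Hs.
  destruct (bqf_coef_bound Q alpha beta s 0 Ha Hb Hc) as (K & HK & Hbound); [lra|lra|].
  apply zeta2_dominated_sum with (Re s - 0 - 1 / 2) K; [lra|assumption|]; intros i.
  (* For [r = 0] and one coefficient, the left side of the Taylor bound is the modulus of the term
     itself. *)
  eapply Rle_trans; [|exact (Hbound i 1%nat)]; right; simpl rsum.
  rewrite Rplus_0_r, Rmult_1_r; f_equal; unfold bqf_coef.
  replace (exp_coef 0) with 1 by (unfold exp_coef; simpl; field).
  rewrite Cmult_1_r; f_equal.
  destruct i as [m [|q]]; unfold diff_snd; simpl; ring.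
Qed.

Lemma bqf_ex_sum Q alpha beta s :
  0 < qa Q -> 0 < qb Q -> 0 < qc Q -> 1 < Re s ->
  exists l, is_unordered_sum (fun i => lattice_char alpha beta i * bqf_term Q s i)%C l.
Proof.
  intros Ha Hb Hc Hs.
  destruct (bqf_ln_bounds Q Ha Hb Hc) as (l & K & _ & Hlow & _).
  apply zeta2_dominated_sum with (Re s - 1) (exp (- (Re s * l)));
    [lra|left; apply exp_pos|]; intros [m q].
  rewrite Cmod_mult, Cmod_lattice_char, Rmult_1_l, Cmod_bqf_term.
  assert (H := lattice_norm_le_zeta2 (Re s - 1) m q ltac:(lra)).
  apply Rle_trans with (exp (- (Re s * l)) *
    exp (- (2 * (1 + (Re s - 1))) * ln (lattice_norm m q))).
  - rewrite <- exp_plus; apply exp_le_compat.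
    assert (H1 := Rmult_le_compat_l (Re s) _ _ ltac:(lra) (Hlow m q)); lra.
  - apply Rmult_le_compat_l; [left; apply exp_pos|exact H].
Qed.

Lemma bqf_term_ZQ Q alpha beta s i :
  (lattice_char alpha beta i * bqf_term Q s i =
   e2pi (alpha * INR (S (fst i)) + beta * INR (snd i))%R /
     Rcpow (bqf_eval Q (INR (S (fst i))) (INR (snd i))) s)%C.
Proof. unfold bqf_term, Rcpow; now rewrite Cexp_opp. Qed.

(* Partial fractions: [Q = c (q + w' p) (q + w p)] and [c (w - w') = 1]. *)
Lemma bqf_term_1 Q w' w i :
  0 < qa Q -> 0 < qb Q -> 0 < qc Q -> discriminant Q = 1 -> 0 < w' -> w' < w ->
  bqf_eval Q 1 (- w') = 0 -> bqf_eval Q 1 (- w) = 0 ->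
  bqf_term Q 1%R i = (hzn_term w' i - hzn_term w i)%C.
Proof.
  intros Ha Hb Hc Hdisc Hw' Hww E1 E2.
  destruct Q as [a b c]; unfold discriminant, bqf_eval in *; simpl qa in *; simpl qb in *;
    simpl qc in *.
  (* Vieta for [c x^2 - b x + a]: subtracting the root equations and cancelling [w - w'] gives the
     sum. The discriminant is then [c^2 (w - w')^2 = 1], and [c > 0] fixes the sign of the root. *)
  assert (Hsum : c * (w + w') = b).
  { apply Rmult_eq_reg_r with (w - w'); [|lra]; nra. }
  assert (Hprod : a = c * w * w') by nra.
  assert (Hdiff : c * (w - w') = 1).
  { assert (H : (c * (w - w')) ^ 2 = 1 ^ 2) by (rewrite <- Hsum, Hprod in Hdisc; nra).
    assert (0 < c * (w - w')) by (apply Rmult_lt_0_compat; lra). nra. }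
  unfold bqf_term, bqf_ln, hzn_term, hzn_freq, bqf_eval; simpl qa; simpl qb; simpl qc.
  assert (Hp := INR_S_pos (fst i)); assert (Hq := pos_INR (snd i)).
  set (p := INR (S (fst i))) in *; set (q := INR (snd i)) in *.
  assert (P1 : 0 < p * w' + q) by (assert (0 < p * w') by (apply Rmult_lt_0_compat; lra); lra).
  assert (P2 : 0 < p * w + q) by (assert (0 < p * w) by (apply Rmult_lt_0_compat; lra); lra).
  replace (a * p ^ 2 + b * p * q + c * q ^ 2) with (c * ((p * w' + q) * (p * w + q)))
    by (rewrite <- Hsum, Hprod; ring).
  rewrite Cmult_1_l, <- RtoC_opp, Cexp_RtoC, exp_Ropp, exp_ln
    by (repeat apply Rmult_lt_0_compat; assumption).
  rewrite <- RtoC_minus; f_equal.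
  replace (/ (p * (p * w' + q)) - / (p * (p * w + q)))
    with ((w - w') / ((p * w' + q) * (p * w + q))) by (field; repeat split; lra).
  replace (w - w') with (/ c) by (apply Rmult_eq_reg_l with c; [rewrite Hdiff; field|]; lra).
  field; repeat split; lra.
Qed.

(** The double series defines [Z] for [Re s > 1], and analyticity on the connected half-plane
    [Re s > 1/2] then determines it there. The value at 1 is that of this continuation, built as the
    transformed sum divided by [1 - e2pi beta]. *)
Theorem theorem2p2 (alpha beta : R)
  (Halpha : non_integer alpha) (Hbeta : non_integer beta)
  (Q : bqf) (HQ : indefinite Q)
  (Ha : 0 < qa Q) (Hb : 0 < qb Q) (Hc : 0 < qc Q)
  (Hdisc : discriminant Q = 1)
  (w' w : R) (Hw'0 : 0 < w') (Hw'w : w' < w)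
  (Hrw' : bqf_eval Q 1 (- w') = 0) (Hrw : bqf_eval Q 1 (- w) = 0) :
  exists Z : C -> C,
    (forall s : C, 1 < Re s -> is_ZQ Q alpha beta s (Z s)) /\
    analytic_on (fun s : C => 1 / 2 < Re s) Z /\
    Z 1%R = (HZN 2 w' alpha beta - HZN 2 w alpha beta)%C.
Proof.
  assert (HB := e2pi_neq_1 beta Hbeta).
  set (G := fun s i => (lattice_char alpha beta i * diff_snd (bqf_term Q s) i)%C).
  (* The condition on [s] stands under the existential so that choice yields a total function;
     outside the half-plane its value is arbitrary. *)
  assert (HS : forall s, exists l, 1 / 2 < Re s -> is_unordered_sum (G s) l).
  { intros s; destruct (Rlt_dec (1 / 2) (Re s)) as [Hs|Hs].
    - destruct (bqf_ex_diff_sum Q alpha beta s Ha Hb Hc Hs) as [l Hl]; now exists l.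
    - exists 0; intros; contradiction. }
  apply functional_choice in HS; destruct HS as [S HS].
  exists (fun s => / (1 - e2pi beta) * S s)%C; split; [|split].
  - intros s Hs; destruct (bqf_ex_sum Q alpha beta s Ha Hb Hc Hs) as [l Hl].
    replace (/ (1 - e2pi beta) * S s)%C with l.
    + unfold is_ZQ; eapply is_unordered_sum_ext; [|exact Hl].
      intros i; apply bqf_term_ZQ.
    + rewrite (is_unordered_sum_unique (G s) (S s) ((1 - e2pi beta) * l)).
      * field; assumption.
      * apply HS; lra.
      * now apply is_unordered_sum_diff_snd.
  (* Half the distance to the line [Re s = 1/2], so that the margin [eps] left for the majorant
     equals [r]. *)
  - intros z0 Hz0; set (r := (Re z0 - 1 / 2) / 2).
    assert (Hr : 0 < r) by (unfold r; lra).
    destruct (bqf_coef_bound Q alpha beta z0 r Ha Hb Hc) as (K & HK & Hbound);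
      [lra|unfold r; lra|].
    set (eps := Re z0 - r - 1 / 2) in *; assert (He : 0 < eps) by (unfold eps, r; lra).
    destruct (is_pseries_unordered_sum (fun h => G (z0 + h)%C) (bqf_coef Q alpha beta z0)
      (fun h => S (z0 + h)%C) (fun i => K * zeta2_term eps i)
      (K * ((1 + / eps) * (1 + / eps))) r Hr Hbound) as [a Hpser].
    + apply sums_bounded_scal; [assumption|now apply zeta2_sums_bounded].
    + intros h i _; apply bqf_coef_series.
    + intros h Hh; apply HS; rewrite re_plus.
      assert (H := re_le_Cmod h); apply Rabs_le_between in H; unfold r in *; lra.
    + exists (PS_scal (K := C_AbsRing) (V := C_NormedModule) (/ (1 - e2pi beta))%C a),
        (mkposreal r Hr).
      intros z Hz; simpl in Hz.
      replace z with (z0 + (z - z0))%C at 2 by ring.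
      apply (is_pseries_scal (K := C_AbsRing) (V := C_NormedModule)).
      * apply Cmult_comm.
      * now apply Hpser.
  - destruct (hzn_ex_sum w' alpha beta) as [U1 H1]; [lra|].
    destruct (hzn_ex_sum w alpha beta) as [U2 H2]; [lra|].
    rewrite (HZN_2_value w' alpha beta) with (U := U1) by assumption.
    rewrite (HZN_2_value w alpha beta) with (U := U2) by (assumption || lra).
    (* The identity at 1 holds between transformed sums: the differencing is linear, so partial
       fractions apply to each term, including those with [q = 0]. *)
    rewrite (is_unordered_sum_unique (G 1%R) (S 1%R) (U1 - U2)).
    + field; assumption.
    + apply HS; unfold Re; simpl; lra.
    + eapply is_unordered_sum_ext; [|apply (is_unordered_sum_minus _ _ _ _ H1 H2)].
      assert (E := fun i => bqf_term_1 Q w' w i Ha Hb Hc Hdisc Hw'0 Hw'w Hrw' Hrw).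
      intros [m [|q]]; unfold G, diff_snd; simpl fst; simpl snd; cbv iota beta;
        rewrite !E; ring.
Qed.
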